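(* (Reduced Model I.) In the setting of the context, let $W$ satisfy the thickness-integrated flow equation $$-\frac{Q}{|\Omega|}\int_{-h}^{h}\sqrt{|G|}\,d\lambda=\int_{-h}^{h}\Big[\sum_{i,j=1}^{2}\partial_i\big(f_\beta(\|\nabla_GW\|_G)\sqrt{|G|}\,G^{ij}\partial_jW\big)+\partial_\lambda\big(f_\beta(\|\nabla_GW\|_G)\sqrt{|G|}\,\partial_\lambda W\big)\Big]d\lambda$$ with $h=h(u,v)$, and the boundary conditions $$W=0\ \text{on }\Gamma_w,\qquad \mathbf v\cdot\mathbf n_f^{\pm}=-q^{\pm}(u,v)\ \text{on }\Gamma_f^{\pm},\qquad \mathbf v\cdot\mathbf n=0\ \text{on }\Gamma_{f_{out}}\cup\Gamma_{out}^{\pm},$$ where $\mathbf v=-f_\beta(\|\nabla_GW\|_G)\nabla_GW$. Assume in addition that the gradient of $W$ (that is, $(\partial_uW,\partial_vW,\partial_\lambda W)$) is independent of $\lambda$. Then $$-\sum_{i,j=1}^{2}\partial_i\big(L^{ij}\,\partial_jW\big)=\frac{Q}{|\Omega|}A+\tilde q^+(u,v)+\tilde q^-(u,v),$$ where $$L^{ij}=\int_{-h}^{h}f_\beta(\|\nabla_GW\|_G)\sqrt{|G|}\,G^{ij}\,d\lambda,\qquad A=\int_{-h}^{h}\sqrt{|G|}\,d\lambda,\qquad \tilde q^{\pm}(u,v)=q^{\pm}\sqrt{1+h_u^2+h_v^2}\,\sqrt{|G|}\,\Big|_{\lambda=\pm h(u,v)} .$$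
   Context: Geometry. $\mathbf r(u,v)$, $0\le u\le L$, $a\le v\le b$, is a smooth surface immersed in $\mathbb R^3$ with unit normal $\mathbf n(u,v)=\frac{\mathbf r_u\times\mathbf r_v}{\|\mathbf r_u\times\mathbf r_v\|}$, and $h(u,v)>0$ is a smooth function. The fracture is $\mathbf R(u,v,\lambda)=\mathbf r(u,v)+\lambda\,\mathbf n(u,v)$, $-h(u,v)\le\lambda\le h(u,v)$, assumed to be an immersion. $G=[G_{ij}]$ is the induced metric, $G_{ij}=\langle\partial_i\mathbf R,\partial_j\mathbf R\rangle$, with $\partial_1=\partial_u,\partial_2=\partial_v,\partial_3=\partial_\lambda$; $|G|=\det G$, $G^{-1}=[G^{ij}]$. One has $G_{13}=G_{23}=0$, $G_{33}=1$. In coordinates: $\Omega_f=\{0<u<L,\ a<v<b,\ -h(u,v)<\lambda<h(u,v)\}$; $\Gamma_w$ is the part of $\partial\Omega_f$ with $u=0$; $\Gamma_f^\pm$ the part with $\lambda=\pm h(u,v)$; $\Gamma_{f_{out}}$ the part with $u=L$; $\Gamma_{out}^+$, $\Gamma_{out}^-$ the parts with $v=b$, $v=a$. Operators. $(\nabla_G\phi)^j=\sum_{i=1}^3G^{ij}\partial_i\phi$, $\|\nabla_G\phi\|_G^2=\sum_{i,j=1}^3G^{ij}\partial_i\phi\,\partial_j\phi$. $f_\beta(s)=\dfrac{2}{\alpha+\sqrt{\alpha^2+4\beta s}}$ with constants $\alpha>0,\beta\ge0$. Normals. In boundary conditions, $\mathbf v\cdot\mathbf n$ is the dot product of the coordinate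 components $(v^1,v^2,v^3)$ in $(u,v,\lambda)$-coordinates with the unit outward normal in $(u,v,\lambda)$-space; in particular $\mathbf n_f^{\pm}=\frac{\langle -h_u,-h_v,\pm1\rangle}{\sqrt{1+h_u^2+h_v^2}}$ on $\Gamma_f^\pm$. $Q$ and $|\Omega|>0$ are constants, $q^\pm(u,v)$ are given functions; $W$ and its gradient are $C^2$ on $\overline{\Omega_f}$. *)

(* Defs.v *)
From Stdlib Require Export Reals.
From Coquelicot Require Export Coquelicot.
From mathcomp Require Export all_boot all_algebra Rstruct.

Set Implicit Arguments.
Unset Strict Implicit.
Unset Printing Implicit Defensive.

Import GRing.Theory.
Local Open Scope ring_scope.

(* Scalars are Stdlib's R, which Rstruct makes a MathComp field, so that the
   matrix operations apply to it; limits, derivatives and integrals are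
   Coquelicot's.  (u, v) is a point of R2 and (u, v, lambda) = ((u, v), lambda)
   a point of R3, so p.1 is the (u, v)-part of p : R3 and p.2 its lambda. *)
Definition R2 : Type := (R * R)%type.
Definition R3 : Type := (R * R * R)%type.

Definition e2 (i : 'I_2) : R * R :=
  ((i == 0%N :> nat)%:R, (i == 1%N :> nat)%:R).
Definition e3 (i : 'I_3) : R * R * R :=
  ((i == 0%N :> nat)%:R, (i == 1%N :> nat)%:R, (i == 2%N :> nat)%:R).

Section Smoothness.
Variables (V : NormedModule R_AbsRing) (n : nat) (e : 'I_n -> V).

Definition along (f : V -> R) (p : V) (i : 'I_n) (t : R) : R :=
  f (plus p (scal t (e i))).

(* Partial derivative in the i-th coordinate. *)
Definition pd (i : 'I_n) (f : V -> R) (p : V) : R := Derive (along f p i) 0.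

Fixpoint Ck_open (k : nat) (U : V -> Prop) (f : V -> R) : Prop :=
  (forall p, U p -> continuous f p) /\
  if k is k'.+1 then
    forall i, (forall p, U p -> ex_derive (along f p i) 0) /\
              Ck_open k' U (pd i f)
  else True.

(* Regularity on a non-open set S (in practice a compact region with its
   boundary) means regularity on some open neighbourhood of S; the values of f
   off S serve only to give its derivatives at the boundary points of S. *)
Definition Ck_on (k : nat) (S : V -> Prop) (f : V -> R) : Prop :=
  exists U : V -> Prop,
    [/\ open U, forall p, S p -> U p & Ck_open k U f].

Definition smooth_on (S : V -> Prop) (f : V -> R) : Prop :=
  exists U : V -> Prop,
    [/\ open U, forall p, S p -> U p & forall k, Ck_open k U f].

(* Row i is the partial derivative of F in the i-th coordinate. *)
Definition jacobian (F : V -> 'rV[R]_3) (p : V) : 'M[R]_(n, 3) :=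
  \matrix_(i, c) pd i (fun q => F q 0 c) p.

Definition immersion_on (S : V -> Prop) (F : V -> 'rV[R]_3) : Prop :=
  forall p, S p -> row_free (jacobian F p).

End Smoothness.

Definition dot (x y : 'rV[R]_3) : R := \sum_c x 0 c * y 0 c.
Definition norm3 (x : 'rV[R]_3) : R := sqrt (dot x x).

Definition vec3 (x y z : R) : 'rV[R]_3 :=
  \row_c (if c == 0%N :> nat then x else if c == 1%N :> nat then y else z).

Definition cross (x y : 'rV[R]_3) : 'rV[R]_3 :=
  let x_ k := x 0 (inord k) in let y_ k := y 0 (inord k) in
  vec3 (x_ 1%N * y_ 2%N - x_ 2%N * y_ 1%N)
       (x_ 2%N * y_ 0%N - x_ 0%N * y_ 2%N)
       (x_ 0%N * y_ 1%N - x_ 1%N * y_ 0%N).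

Section Domain.
Variables (L a b : R) (h : R2 -> R).

Definition rect_open (p : R2) : Prop := (0 < p.1 < L) /\ (a < p.2 < b).
Definition rect_closed (p : R2) : Prop := (0 <= p.1 <= L) /\ (a <= p.2 <= b).

Definition Omega_f (p : R3) : Prop :=
  rect_open p.1 /\ (- h p.1 < p.2 < h p.1).
Definition Omega_f_closure (p : R3) : Prop :=
  rect_closed p.1 /\ (- h p.1 <= p.2 <= h p.1).

(* The pieces of the boundary are closed faces: every point of
   Omega_f_closure satisfying one of these equations is a boundary point. *)
Definition Gamma_w (p : R3) : Prop := Omega_f_closure p /\ p.1.1 = 0.
Definition Gamma_f_plus (p : R3) : Prop := Omega_f_closure p /\ p.2 = h p.1.
Definition Gamma_f_minus (p : R3) : Prop := Omega_f_closure p /\ p.2 = - h p.1.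
Definition Gamma_f_out (p : R3) : Prop := Omega_f_closure p /\ p.1.1 = L.
Definition Gamma_out_plus (p : R3) : Prop := Omega_f_closure p /\ p.1.2 = b.
Definition Gamma_out_minus (p : R3) : Prop := Omega_f_closure p /\ p.1.2 = a.

Definition h_u (p : R2) : R := pd e2 ord0 h p.
Definition h_v (p : R2) : R := pd e2 ord_max h p.

Definition area_factor (p : R2) : R := sqrt (1 + h_u p ^+ 2 + h_v p ^+ 2).

(* Unit outward normals in (u, v, lambda)-space. *)
Definition n_f_plus (p : R2) : 'rV[R]_3 :=
  (area_factor p)^-1 *: vec3 (- h_u p) (- h_v p) 1.
Definition n_f_minus (p : R2) : 'rV[R]_3 :=
  (area_factor p)^-1 *: vec3 (- h_u p) (- h_v p) (-1).
Definition n_f_out : 'rV[R]_3 := vec3 1 0 0.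
Definition n_out_plus : 'rV[R]_3 := vec3 0 1 0.
Definition n_out_minus : 'rV[R]_3 := vec3 0 (-1) 0.

End Domain.

Section Geometry.
Variable r : R2 -> 'rV[R]_3.

Definition unit_normal (p : R2) : 'rV[R]_3 :=
  let c := cross (row ord0 (jacobian e2 r p)) (row ord_max (jacobian e2 r p)) in
  (norm3 c)^-1 *: c.

Definition fracture (p : R3) : 'rV[R]_3 := r p.1 + p.2 *: unit_normal p.1.

Definition metric (p : R3) : 'M[R]_3 :=
  \matrix_(i, j) dot (row i (jacobian e3 fracture p))
                     (row j (jacobian e3 fracture p)).

Definition sqrt_detG (p : R3) : R := sqrt (\det (metric p)).

Definition Ginv (p : R3) (i j : 'I_3) : R := invmx (metric p) i j.

Definition gradG (phi : R3 -> R) (p : R3) : 'rV[R]_3 :=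
  \row_j \sum_(i < 3) Ginv p i j * pd e3 i phi p.

Definition normG_grad (phi : R3 -> R) (p : R3) : R :=
  sqrt (\sum_(i < 3) \sum_(j < 3)
          Ginv p i j * pd e3 i phi p * pd e3 j phi p).

Variables alpha beta : R.

Definition f_beta (s : R) : R :=
  2%:R / (alpha + sqrt (alpha ^+ 2 + 4%:R * beta * s)).

Definition velocity (W : R3 -> R) (p : R3) : 'rV[R]_3 :=
  - (f_beta (normG_grad W p) *: gradG W p).

Variable h : R2 -> R.

Definition area_A (p : R2) : R :=
  RInt (fun l => sqrt_detG (p, l)) (- h p) (h p).

Definition Lcoef (W : R3 -> R) (i j : 'I_3) (p : R2) : R :=
  RInt (fun l => f_beta (normG_grad W (p, l)) * sqrt_detG (p, l)
                 * Ginv (p, l) i j)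
       (- h p) (h p).

Definition q_tilde_plus (q : R2 -> R) (p : R2) : R :=
  q p * area_factor h p * sqrt_detG (p, h p).
Definition q_tilde_minus (q : R2 -> R) (p : R2) : R :=
  q p * area_factor h p * sqrt_detG (p, - h p).

End Geometry.

(* Main.v *)
Require Import Defs.
From mathcomp Require Import all_order ring lra.
From Stdlib Require Import Classical IndefiniteDescription.

(* Put K^ij = f_beta(|grad W|) sqrt|G| G^ij d_j W.  Since grad W does not depend
   on lambda, L^ij d_j W is the integral of K^ij over [-h, h], and Leibniz' rule
   gives d_i (L^ij d_j W) = \int d_i K^ij + h_i (K^ij(h) + K^ij(-h)).  In the flow
   equation the lambda-derivative integrates to its boundary values; as
   G^i3 = delta_i3, these combine with the terms h_i K^ij(+-h) into the normal
   component of the velocity on Gamma_f^+-, which is the flux q^+-.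

   Leibniz' rule needs K^ij to be C^1 although |grad W| is not differentiable
   where grad W vanishes.  With J the Jacobian of the fracture, G = J J^T, and
   w = J^-1 grad W is a C^1 field with |w| = |grad W|_G; the products
   f_beta(|w|) w_c are C^1, because |w| enters their derivatives only through
   f_beta'(|w|) (w . dw) w_c / |w|, which is at most |f_beta'(|w|) (w . dw)| and
   hence tends to 0 where w vanishes. *)

Set Implicit Arguments.
Unset Strict Implicit.
Unset Printing Implicit Defensive.

Import Order.TTheory GRing.Theory Num.Theory.
Local Open Scope ring_scope.

(** * Functions of class C^k *)

Section Regularity.
Variables (V : NormedModule R_AbsRing) (n : nat) (e : 'I_n -> V).
Implicit Types (U : V -> Prop) (f g : V -> R) (p : V) (i : 'I_n).

Lemma along0 f p i : along e f p i 0 = f p.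
Proof. by rewrite /along scal_zero_l plus_zero_r. Qed.

Lemma along_shift f p i s t :
  along e f (plus p (scal s (e i))) i t = along e f p i (s + t)%R.
Proof. by rewrite /along -plus_assoc -scal_distr_r. Qed.

Lemma continuous_line p i t :
  continuous (fun s : R => plus p (scal s (e i))) t.
Proof.
apply: continuous_plus; first exact: continuous_const.
by apply: continuous_scal_l; apply: continuous_id.
Qed.

Lemma continuous_along f p i t :
  continuous f (plus p (scal t (e i))) -> continuous (along e f p i) t.
Proof. exact: continuous_comp (@continuous_line p i t). Qed.

Lemma near_line U p i : open U -> U p ->
  locally (0 : R) (fun t : R => U (plus p (scal t (e i)))).
Proof.
move=> oU Up; apply: (@continuous_line p i 0).
by apply: oU; rewrite scal_zero_l plus_zero_r.
Qed.

Lemma pd_eq f p i l : is_derive (along e f p i) 0 l -> pd e i f p = l.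
Proof. by move=> H; apply: is_derive_unique. Qed.

Lemma is_derive_along_ext U f g p i l : open U -> U p ->
  (forall q, U q -> f q = g q) ->
  is_derive (along e f p i) 0 l -> is_derive (along e g p i) 0 l.
Proof.
move=> oU Up fg; apply: is_derive_ext_loc.
by apply: filter_imp (near_line i oU Up) => t Ut; apply: fg.
Qed.

Lemma pd_ext U f g p i : open U -> U p ->
  (forall q, U q -> f q = g q) -> pd e i f p = pd e i g p.
Proof.
move=> oU Up fg; apply: Derive_ext_loc.
by apply: filter_imp (near_line i oU Up) => t Ut; apply: fg.
Qed.

Lemma continuous_ext_open U f g p : open U -> U p ->
  (forall q, U q -> f q = g q) -> continuous f p -> continuous g p.
Proof.
move=> oU Up fg; apply: continuous_ext_loc.
by apply: filter_imp (oU _ Up) => q Uq; rewrite fg.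
Qed.

Lemma Ck_continuous k U f p : Ck_open e k U f -> U p -> continuous f p.
Proof. by case: k => [|k] [H _] /H. Qed.

Lemma Ck_pd k U f i : Ck_open e k.+1 U f -> Ck_open e k U (pd e i f).
Proof. by case=> _ /(_ i) []. Qed.

Lemma Ck_is_derive k U f i p : Ck_open e k.+1 U f -> U p ->
  is_derive (along e f p i) 0 (pd e i f p).
Proof. by case=> _ /(_ i) [H _] /H /Derive_correct. Qed.

Lemma Ck_ext k U f g : open U -> (forall q, U q -> f q = g q) ->
  Ck_open e k U f -> Ck_open e k U g.
Proof.
move=> oU; elim: k f g => [|k IH] f g fg [Cf Df]; split.
- by move=> p Up; apply: (continuous_ext_open oU Up fg); apply: Cf.
- by [].
- by move=> p Up; apply: (continuous_ext_open oU Up fg); apply: Cf.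
- move=> i; case: (Df i) => Ef Pf; split=> [p Up|].
    case: (Ef p Up) => l Hl; exists l.
    exact: (is_derive_along_ext oU Up fg).
  by apply: IH Pf => q Uq; apply: (pd_ext _ oU).
Qed.

(** Introduction rule: a partial derivative [g] computed by hand may stand for [pd e i f]. The two
    agree only on [U], which suffices because [U] is open and derivatives are local. *)
Lemma Ck_S k U f : open U -> (forall p, U p -> continuous f p) ->
  (forall i, exists2 g, (forall p, U p -> is_derive (along e f p i) 0 (g p)) &
     Ck_open e k U g) ->
  Ck_open e k.+1 U f.
Proof.
move=> oU Cf Df; split=> // i; case: (Df i) => g Dg Cg; split=> [p Up|].
  by exists (g p); apply: Dg.
by apply: Ck_ext Cg => // q Uq; rewrite (pd_eq (Dg q Uq)).
Qed.

Lemma Ck_lower k m U f : (k <= m)%N -> Ck_open e m U f -> Ck_open e k U f.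
Proof.
elim: k m f => [|k IH] [|m] f //= km [Cf Df]; split=> // i.
by case: (Df i) => Ef Pf; split=> //; apply: IH Pf.
Qed.

Lemma Ck_subset k U U' f : (forall p, U' p -> U p) ->
  Ck_open e k U f -> Ck_open e k U' f.
Proof.
move=> sU; elim: k f => [|k IH] f [Cf Df]; split=> //.
- by move=> p /sU; apply: Cf.
- by move=> p /sU; apply: Cf.
- by move=> i; case: (Df i) => Ef Pf; split=> [p /sU /Ef|] //; apply: IH.
Qed.

Lemma Ck_const k U (c : R) : open U -> Ck_open e k U (fun=> c).
Proof.
move=> oU; elim: k c => [|k IH] c; first by split=> // p _; apply: continuous_const.
apply: Ck_S => // [p _|i]; first exact: continuous_const.
by exists (fun=> 0) => // p _; apply: is_derive_const.
Qed.

Lemma Ck_add k U f g : open U -> Ck_open e k U f -> Ck_open e k U g ->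
  Ck_open e k U (fun p => f p + g p).
Proof.
move=> oU; elim: k f g => [|k IH] f g Cf Cg.
  split=> // p Up; apply: continuous_plus;
    [exact: (Ck_continuous Cf Up)|exact: (Ck_continuous Cg Up)].
apply: Ck_S => // [p Up|i].
  apply: continuous_plus;
    [exact: (Ck_continuous Cf Up)|exact: (Ck_continuous Cg Up)].
exists (fun p => pd e i f p + pd e i g p); last by apply: IH; apply: Ck_pd.
move=> p Up; apply: is_derive_plus; [exact: (Ck_is_derive _ Cf Up)|exact: (Ck_is_derive _ Cg Up)].
Qed.

Lemma Ck_mul k U f g : open U -> Ck_open e k U f -> Ck_open e k U g ->
  Ck_open e k U (fun p => f p * g p).
Proof.
move=> oU; elim: k f g => [|k IH] f g Cf Cg.
  split=> // p Up; apply: (@continuous_mult _ R_AbsRing);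
    [exact: (Ck_continuous Cf Up)|exact: (Ck_continuous Cg Up)].
apply: Ck_S => // [p Up|i].
  apply: (@continuous_mult _ R_AbsRing);
    [exact: (Ck_continuous Cf Up)|exact: (Ck_continuous Cg Up)].
exists (fun p => pd e i f p * g p + f p * pd e i g p).
  move=> p Up; have Df := Ck_is_derive i Cf Up; have Dg := Ck_is_derive i Cg Up.
  have := is_derive_mult _ _ _ _ _ Df Dg Rmult_comm.
  by rewrite !along0.
apply: Ck_add => //; apply: IH => //; try exact: Ck_pd.
- exact: Ck_lower Cg.
- exact: Ck_lower Cf.
Qed.

Lemma Ck_opp k U f : open U -> Ck_open e k U f -> Ck_open e k U (fun p => - f p).
Proof.
move=> oU Cf; apply: (@Ck_ext _ _ (fun p => -1 * f p)) => // [q _|].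
  by rewrite mulN1r.
by apply: Ck_mul => //; apply: Ck_const.
Qed.

Lemma Ck_sub k U f g : open U -> Ck_open e k U f -> Ck_open e k U g ->
  Ck_open e k U (fun p => f p - g p).
Proof. by move=> oU Cf Cg; apply: Ck_add => //; apply: Ck_opp. Qed.

Lemma continuous_inv (T : UniformSpace) (f : T -> R) x :
  continuous f x -> f x <> 0 -> continuous (fun y => (f y)^-1) x.
Proof. by move=> Cf fx; apply: continuous_comp Cf (continuous_Rinv _ fx). Qed.

Lemma Ck_inv k U f : open U -> (forall p, U p -> f p <> 0) ->
  Ck_open e k U f -> Ck_open e k U (fun p => (f p)^-1).
Proof.
move=> oU f0; elim: k => [|k IH] Cf.
  split=> // p Up; apply: continuous_inv; [exact: (Ck_continuous Cf Up)|exact: f0].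
apply: Ck_S => // [p Up|i].
  apply: continuous_inv; [exact: (Ck_continuous Cf Up)|exact: f0].
(* The derivative of 1/f contains 1/f itself, needed only at the lower order [k], where the
   induction hypothesis provides it. *)
have Ci : Ck_open e k U (fun p => (f p)^-1) by apply: IH; exact: Ck_lower Cf.
exists (fun p => - pd e i f p * ((f p)^-1 * (f p)^-1)).
  move=> p Up; have Df := Ck_is_derive i Cf Up.
  have := is_derive_inv _ _ _ Df; rewrite along0 => /(_ (f0 p Up)).
  by rewrite RdivE RpowE expr2 invfM.
apply: Ck_mul => //; [apply: Ck_opp => //; exact: Ck_pd|exact: Ck_mul].
Qed.

Lemma Ck_sqrt k U f : open U -> (forall p, U p -> 0 < f p) ->
  Ck_open e k U f -> Ck_open e k U (fun p => sqrt (f p)).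
Proof.
move=> oU f0; elim: k => [|k IH] Cf.
  split=> // p Up; apply: continuous_comp (continuous_sqrt _).
  exact: (Ck_continuous Cf Up).
apply: Ck_S => // [p Up|i].
  apply: continuous_comp (continuous_sqrt _); exact: (Ck_continuous Cf Up).
have Ci : Ck_open e k U (fun p => sqrt (f p)) by apply: IH; exact: Ck_lower Cf.
exists (fun p => pd e i f p * (2 * sqrt (f p))^-1).
  move=> p Up; have Df := Ck_is_derive i Cf Up.
  have := is_derive_sqrt _ _ _ Df; rewrite along0 => /(_ (elimT RltP (f0 p Up))).
  by rewrite RdivE.
apply: Ck_mul => //; first exact: Ck_pd.
apply: Ck_inv => // [p Up|]; last by apply: Ck_mul => //; apply: Ck_const.
by apply/eqP; rewrite mulf_neq0 ?pnatr_eq0 //; apply/eqP/Rgt_not_eq/sqrt_lt_R0/RltP/f0.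
Qed.

Lemma Ck_sum k U (I : Type) (s : seq I) (P : pred I) (F : I -> V -> R) :
  open U -> (forall j, Ck_open e k U (F j)) ->
  Ck_open e k U (fun p => \sum_(j <- s | P j) F j p).
Proof.
move=> oU CF; elim: s => [|j s IH].
  by apply: Ck_ext (@Ck_const k U 0 oU) => // q _; rewrite big_nil.
case Pj: (P j).
  by apply: Ck_ext (Ck_add oU (CF j) IH) => // q _; rewrite big_cons Pj.
by apply: Ck_ext IH => // q _; rewrite big_cons Pj.
Qed.

Lemma Ck_prod k U (I : Type) (s : seq I) (P : pred I) (F : I -> V -> R) :
  open U -> (forall j, Ck_open e k U (F j)) ->
  Ck_open e k U (fun p => \prod_(j <- s | P j) F j p).
Proof.
move=> oU CF; elim: s => [|j s IH].
  by apply: Ck_ext (@Ck_const k U 1 oU) => // q _; rewrite big_nil.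
case Pj: (P j).
  by apply: Ck_ext (Ck_mul oU (CF j) IH) => // q _; rewrite big_cons Pj.
by apply: Ck_ext IH => // q _; rewrite big_cons Pj.
Qed.

Lemma Ck_det k U m (A : V -> 'M[R]_m) : open U ->
  (forall i j : 'I_m, Ck_open e k U (fun p => A p i j)) ->
  Ck_open e k U (fun p => \det (A p)).
Proof.
move=> oU CA; rewrite /determinant; apply: Ck_sum => // s.
apply: Ck_mul => //; first exact: Ck_const.
by apply: Ck_prod => // i; apply: CA.
Qed.

(** Cramer's rule writes the entries of the inverse as cofactors over the determinant, and cofactors
    are signed determinants of minors. *)
Lemma Ck_invmx k U m (A : V -> 'M[R]_m) : open U ->
  (forall p, U p -> \det (A p) <> 0) ->
  (forall i j : 'I_m, Ck_open e k U (fun p => A p i j)) ->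
  forall i j : 'I_m, Ck_open e k U (fun p => invmx (A p) i j).
Proof.
move=> oU detA CA i j.
apply: (@Ck_ext _ _ (fun p => (\det (A p))^-1 * cofactor (A p) j i)) => //.
  move=> q Uq; rewrite /invmx unitmxE unitfE.
  by move/eqP: (detA q Uq) => ->; rewrite !mxE.
apply: Ck_mul => //; first by apply: Ck_inv => //; apply: Ck_det.
apply: Ck_mul => //; first exact: Ck_const.
apply: Ck_det => // s t.
by apply: Ck_ext (CA (lift j s) (lift i t)) => // q _; rewrite !mxE.
Qed.

(** [pd] differentiates at parameter 0 only. The derivative at parameter [t] is the one at 0 along
    the same line restarted at the shifted base point, composed with the translation s - t. *)
Lemma is_derive_along k U f p i t : Ck_open e k.+1 U f ->
  U (plus p (scal t (e i))) ->
  is_derive (along e f p i) t (pd e i f (plus p (scal t (e i)))).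
Proof.
move=> Cf Up; have D := Ck_is_derive i Cf Up.
have Dm : is_derive (fun s : R => s - t) t 1.
  by rewrite -[X in is_derive _ _ X]subr0; apply: is_derive_minus;
     [exact: is_derive_id|exact: is_derive_const].
have := @is_derive_comp _ _ (along e f (plus p (scal t (e i))) i)
  (fun s : R => s - t) t _ 1.
rewrite subrr => /(_ _ D Dm); rewrite scal_one.
by apply: is_derive_ext => s; rewrite along_shift addrC subrK.
Qed.

End Regularity.

(** * Smoothness of the nonlinear flux *)

Lemma continuous_mulr (T : UniformSpace) (f g : T -> R) x :
  continuous f x -> continuous g x -> continuous (fun y => f y * g y) x.
Proof. exact: (@continuous_mult _ R_AbsRing). Qed.

Lemma continuous_addr (T : UniformSpace) (f g : T -> R) x :
  continuous f x -> continuous g x -> continuous (fun y => f y + g y) x.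
Proof. exact: (@continuous_plus T _ R_NormedModule). Qed.

Lemma continuous_sum (T : UniformSpace) (I : Type) (s : seq I)
    (F : I -> T -> R) x :
  (forall j, continuous (F j) x) -> continuous (fun y => \sum_(j <- s) F j y) x.
Proof.
move=> CF; elim: s => [|j s IH].
  by apply: continuous_ext (continuous_const (0 : R) x) => y; rewrite big_nil.
by apply: continuous_ext (continuous_addr (CF j) IH) => y; rewrite big_cons.
Qed.

Lemma ball_R (x : R) (eps : R) (y : R) : ball x eps y <-> `|y - x| < eps.
Proof.
have -> : ball x eps y = Rlt (Rabs (y - x)) eps by [].
by rewrite RabsE; split=> /RltP.
Qed.

(** Meant for f = w_c / |w|, which is bounded by 1 but may be discontinuous at the zeros of w. *)
Lemma continuous_mul0 (T : UniformSpace) (f g : T -> R) x :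
  (forall y, `|f y| <= 1) -> continuous g x -> g x = 0 ->
  continuous (fun y => f y * g y) x.
Proof.
move=> f1 Cg gx0; apply/filterlim_locally => eps.
move/filterlim_locally/(_ eps): Cg; apply: filter_imp => y.
rewrite gx0 mulr0 !ball_R !subr0; apply: le_lt_trans.
by rewrite normrM ler_piMl.
Qed.

Lemma is_derive_val (K : AbsRing) (W : NormedModule K) (f : K -> W) x l l' :
  is_derive f x l -> l = l' -> is_derive f x l'.
Proof. by move=> H <-. Qed.

Lemma is_derive_sum (I : Type) (r : seq I) (F : I -> R -> R) x (l : I -> R) :
  (forall j, is_derive (F j) x (l j)) ->
  is_derive (fun t => \sum_(j <- r) F j t) x (\sum_(j <- r) l j).
Proof.
move=> DF; elim: r => [|j r IH].
  rewrite big_nil; apply: is_derive_ext (is_derive_const (0 : R) x) => t.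
  by rewrite big_nil.
rewrite big_cons; apply: is_derive_ext (is_derive_plus _ _ _ _ _ (DF j) IH) => t.
by rewrite big_cons.
Qed.

(** Since g vanishes at x, the difference quotient of f g is f(x + k) g(x + k) / k, so continuity of
    f is enough. *)
Lemma is_derive_mul_zero (f g : R -> R) (x l : R) :
  continuous f x -> g x = 0 -> is_derive g x l ->
  is_derive (fun t => f t * g t) x (f x * l).
Proof.
move=> Cf gx0 /is_derive_Reals Dg; apply/is_derive_Reals => eps /RltP eps0.
(* [M] will bound |f(x + k)| and [N] bounds |l|; the added 1 keeps both positive, so that eps can be
   shared as M (eps / 2M) + (eps / 2N) N. *)
set M := `|f x| + 1; set N := `|l| + 1.
have M0 : 0 < M by rewrite ltr_wpDl.
have N0 : 0 < N by rewrite ltr_wpDl.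
have e1 : 0 < Order.min 1 (eps / (2 * N)).
  by rewrite lt_min ltr01 divr_gt0 // mulr_gt0.
have /RltP e2 : 0 < eps / (2 * M) by rewrite divr_gt0 // mulr_gt0.
move/filterlim_locally/(_ (mkposreal _ (elimT RltP e1))): Cf => [d1 Hd1].
have [d2 Hd2] := Dg _ e2.
have /RltP d0 : 0 < Order.min (pos d1) (pos d2).
  by rewrite lt_min; apply/andP; split; apply/RltP; apply: cond_pos.
exists (mkposreal _ d0) => k k0 /RltP /=; rewrite lt_min => /andP[/RltP kd1 /RltP kd2].
have /RltP := Hd2 k k0 kd2; rewrite gx0 !RealsE subr0.
have /Hd1 : ball x d1 (x + k).
  by apply/ball_R; rewrite addrC addKr -RabsE; apply/RltP.
move/ball_R; rewrite /= lt_min => /andP[f1 f2] Dk; apply/RltP.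
rewrite mulr0 subr0.
move/eqP: k0 => k0.
have -> : f (x + k) * g (x + k) / k - f x * l =
    f (x + k) * (g (x + k) / k - l) + (f (x + k) - f x) * l by ring.
apply: le_lt_trans (ler_normD _ _) _; rewrite !normrM.
have fM : `|f (x + k)| <= M.
  have -> : f (x + k) = f x + (f (x + k) - f x) by ring.
  by apply: le_trans (ler_normD _ _) _; rewrite lerD2l ltW.
have -> : eps = M * (eps / (2 * M)) + (eps / (2 * N)) * N.
  by field; rewrite !gt_eqF.
apply: ltr_leD.
  apply: le_lt_trans (ler_wpM2r (normr_ge0 _) fM) _.
  by rewrite ltr_pM2l.
apply: ler_pM => //; first exact: ltW.
by rewrite lerDl.
Qed.

Definition df_beta (alpha beta s : R) : R :=
  (- (4 * beta / (sqrt (alpha ^+ 2 + 4 * beta * s)%R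
                  * (alpha + sqrt (alpha ^+ 2 + 4 * beta * s)%R) ^+ 2)))%R.

Section Flux.
Variables (alpha beta : R).
Hypotheses (alpha_gt0 : 0 < alpha) (beta_ge0 : 0 <= beta).

Lemma radicand_gt0 (s : R) : 0 <= s -> 0 < alpha ^+ 2 + 4 * beta * s.
Proof.
by move=> s0; rewrite ltr_pwDl ?exprn_gt0 // !mulr_ge0.
Qed.

(** As alpha > 0, the radicand is positive even at s = 0, so [f_beta] is differentiable up to s = 0;
    the only singularity of f_beta(|w|) comes from the norm. *)
Lemma is_derive_f_beta (s : R) : 0 <= s ->
  is_derive (f_beta alpha beta) s (df_beta alpha beta s).
Proof.
move=> s0; have r0 := radicand_gt0 s0.
have Dr : is_derive (fun t : R => alpha ^+ 2 + 4 * beta * t)%R s (4 * beta).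
  rewrite -[X in is_derive _ _ X]add0r -[X in _ + X]mulr1.
  apply: is_derive_plus; first exact: is_derive_const.
  by apply: is_derive_scal; apply: is_derive_id.
have := is_derive_sqrt _ _ _ Dr (elimT RltP r0) => Ds.
have Dp := is_derive_plus _ _ _ _ _ (is_derive_const alpha s) Ds.
have q0 : 0 < sqrt (alpha ^+ 2 + 4 * beta * s)%R by rewrite RsqrtE sqrtr_gt0.
have p0 : 0 < alpha + sqrt (alpha ^+ 2 + 4 * beta * s)%R by rewrite addr_gt0.
have Di := is_derive_inv _ _ _ Dp (elimN eqP (lt0r_neq0 p0)).
have Dsc := is_derive_scal _ _ (2%:R : R) _ Di.
apply: (is_derive_val Dsc).
rewrite plus_zero_l !RdivE RpowE /df_beta.
move: q0 p0; set t := sqrt _ => q0 p0.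
change (2 * (- (4 * beta / (2 * t)) / (alpha + t) ^+ 2)
        = (- (4 * beta / (t * (alpha + t) ^+ 2)))%R).
by field; rewrite !gt_eqF.
Qed.

Lemma continuous_f_beta (s : R) : 0 <= s -> continuous (f_beta alpha beta) s.
Proof.
by move=> s0; apply: ex_derive_continuous; exists (df_beta alpha beta s); apply: is_derive_f_beta.
Qed.

Lemma continuous_df_beta (s : R) : 0 <= s -> continuous (df_beta alpha beta) s.
Proof.
move=> s0; have r0 := radicand_gt0 s0.
have q0 : 0 < sqrt (alpha ^+ 2 + 4 * beta * s)%R by rewrite RsqrtE sqrtr_gt0.
have p0 : 0 < alpha + sqrt (alpha ^+ 2 + 4 * beta * s)%R by rewrite addr_gt0.
have Cs : continuous (fun t => sqrt (alpha ^+ 2 + 4 * beta * t)%R) s.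
  apply: continuous_comp (continuous_sqrt _).
  apply: continuous_addr; first exact: continuous_const.
  by apply: continuous_mulr; [exact: continuous_const|exact: continuous_id].
apply: (@continuous_opp _ _ R_NormedModule).
apply: continuous_mulr; first exact: continuous_const.
apply: continuous_inv.
  apply: continuous_mulr => //.
  rewrite /GRing.exp /=.
  by apply: continuous_mulr; apply: continuous_addr => //; exact: continuous_const.
by apply/eqP; rewrite mulf_neq0 ?expf_neq0 ?gt_eqF.
Qed.

(** * The field f_beta(|w|) w at the zeros of w *)

Section Singular.
Variables (V : NormedModule R_AbsRing) (n : nat) (e : 'I_n -> V).
Variables (U : V -> Prop) (m : nat) (w : 'I_m -> V -> R).
Hypotheses (oU : open U) (Cw : forall c, Ck_open e 1 U (w c)).

Let s (p : V) : R := sqrt (\sum_c w c p ^+ 2)%R.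

Let s_ge0 p : 0 <= s p.
Proof. by rewrite /s RsqrtE sqrtr_ge0. Qed.

Let le_w_s c p : `|w c p| <= s p.
Proof.
rewrite /s RsqrtE -sqrtr_sqr ler_wsqrtr // (bigD1 c) //= lerDl.
by rewrite sumr_ge0 // => d _; rewrite sqr_ge0.
Qed.

(** The bound extends to the zeros of [s] because 0^-1 = 0 makes the ratio 0 there. *)
Let ratio_le1 c p : `|w c p * (s p)^-1| <= 1.
Proof.
have [->|s0] := eqVneq (s p) 0; first by rewrite invr0 mulr0 normr0.
have s1 : 0 < s p by rewrite lt_neqAle eq_sym s0 s_ge0.
by rewrite normrM normfV (gtr0_norm s1) ler_pdivrMr ?mul1r.
Qed.

Let Csq : Ck_open e 1 U (fun p => \sum_c w c p ^+ 2).
Proof. by apply: Ck_sum => // c; apply: Ck_mul. Qed.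

Let Cs p : U p -> continuous s p.
Proof. by move=> Up; apply: continuous_comp (Ck_continuous Csq Up) (continuous_sqrt _). Qed.

Let w0 p : ~~ (0 < s p) -> forall c, w c p = 0.
Proof.
rewrite -leNgt => s0 c; apply/eqP; rewrite -normr_le0.
exact: le_trans (le_w_s c p) s0.
Qed.

Lemma Ck1_f_beta_mul c :
  Ck_open e 1 U (fun p => f_beta alpha beta (s p) * w c p).
Proof.
have Cf p : U p -> continuous (fun q => f_beta alpha beta (s q)) p.
  move=> Up; apply: continuous_comp (Cs Up) (continuous_f_beta _); exact: s_ge0.
have Cw0 d p : U p -> continuous (w d) p by move=> Up; apply: (Ck_continuous (Cw d)).
apply: Ck_S => // [p Up|i]; first by apply: continuous_mulr; auto.
have Cpd d p : U p -> continuous (pd e i (w d)) p.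
  by move=> Up; apply: (@Ck_continuous _ _ e 0) Up; apply: Ck_pd.
(* Where |w| > 0, [B] is |w| times the i-th derivative of f_beta(|w|). It is continuous on all of
   [U] and vanishes with [w]. *)
pose B p := df_beta alpha beta (s p) * \sum_d w d p * pd e i (w d) p.
have CB p : U p -> continuous B p.
  move=> Up; apply: continuous_mulr.
    apply: continuous_comp (Cs Up) (continuous_df_beta _); exact: s_ge0.
  by apply: continuous_sum => d; apply: continuous_mulr; auto.
(* At a zero of [w] the convention 0^-1 = 0 erases the first term and leaves f_beta(0) d_i w_c, the
   derivative found below for such points. *)
exists (fun p => (w c p * (s p)^-1) * B p
                 + f_beta alpha beta (s p) * pd e i (w c) p).
- move=> p Up; have [s0|/w0 wp0] := boolP (0 < s p).
    have q0 : 0 < \sum_c w c p ^+ 2 by move: s0; rewrite /s RsqrtE sqrtr_gt0.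
    have Dq : is_derive (along e (fun p => \sum_c w c p ^+ 2) p i) 0
        (2 * \sum_d w d p * pd e i (w d) p).
      rewrite mulr_sumr; apply: is_derive_sum => d.
      have Dw := Ck_is_derive i (Cw d) Up.
      apply: (is_derive_val (is_derive_mult _ _ _ _ _ Dw Dw Rmult_comm)).
      rewrite along0; set x := w d p; set y := pd e i (w d) p.
      by change (y * x + x * y = 2 * (x * y)); ring.
    have := is_derive_sqrt _ _ _ Dq.
    rewrite along0 RdivE => /(_ (elimT RltP q0)) Ds.
    have := is_derive_f_beta (s_ge0 p); rewrite -[s p](along0 e s p i) => Df.
    have Dc := is_derive_comp _ _ _ _ _ Df Ds.
    have Dw := Ck_is_derive i (Cw c) Up.
    apply: (is_derive_val (is_derive_mult _ _ _ _ _ Dc Dw Rmult_comm)).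
    rewrite /B !along0.
    set S := \sum_d w d p * pd e i (w d) p.
    have e2 : sqrt (\sum_c w c p ^+ 2)%R = s p by [].
    rewrite e2.
    set x := df_beta _ _ _; set y := pd e i (w c) p; set z := f_beta _ _ _.
    change (((2 * S) / (2 * s p) * x) * w c p + z * y =
            w c p * (s p)^-1 * (x * S) + z * y).
    by field; rewrite gt_eqF.
  have := @is_derive_mul_zero
    (along e (fun q => f_beta alpha beta (s q)) p i) (along e (w c) p i) 0 (pd e i (w c) p).
  rewrite !along0 wp0 !mul0r add0r; apply=> //; last exact: (Ck_is_derive _ (Cw c)).
  apply: continuous_along.
  by rewrite scal_zero_l plus_zero_r; apply: Cf.
- split=> // p Up; apply: continuous_addr; last by apply: continuous_mulr; auto.
  have [s0|/w0 wp0] := boolP (0 < s p).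
    apply: continuous_mulr; last exact: CB.
    apply: continuous_mulr; first exact: Cw0.
    by apply: continuous_inv; [exact: Cs|apply/eqP; rewrite gt_eqF].
  (* The ratio w_c / |w| may jump here, but it is bounded and its cofactor [B] tends to 0. *)
  apply: continuous_mul0 => //; first exact: CB.
  by rewrite /B big1 ?mulr0 // => d _; rewrite wp0 mul0r.
Qed.

End Singular.
End Flux.

(** * Differentiation under the integral sign *)

(** Tube lemma: the segment over [p] is compact, so the radii of the balls around its points that
    fit into [U] can be bounded below uniformly. *)
Lemma tube (U : R3 -> Prop) (p : R2) (c : R) : open U -> 0 <= c ->
  (forall l : R, `|l| <= c -> U (p, l)) ->
  exists2 d : R, 0 < d &
    forall q (l : R), ball p d q -> `|l| < c + d -> U (q, l).
Proof.
move=> oU c0 Uc.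
have [delta Hdelta] : exists delta : R -> posreal, forall t : R, `|t| <= c ->
    forall x, ball (p, t) (delta t) x -> U x.
  apply: (functional_choice (fun (t : R) (e : posreal) => `|t| <= c ->
    forall x, ball (p, t) e x -> U x)) => t.
  (* Off the segment the requirement is vacuous; the radius 1 only makes the choice function
     total. *)
  have [tc|tc] := boolP (`|t| <= c); last by exists (mkposreal 1 Rlt_0_1).
  by have [e He] := oU _ (Uc t tc); exists e => _.
(* Radii are halved so that a point within [d] of some l', with l' within half of [delta t] of t, is
   still within [delta t] of t. *)
have h0 t : Rlt 0 (pos (delta t) / 2)%R.
  by apply/RltP; rewrite divr_gt0 //; apply/RltP/cond_pos.
have [d Hd] := compactness_value_1d (- c) c (fun t => mkposreal _ (h0 t)).
have d0 : 0 < pos d by apply/RltP/cond_pos.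
exists (pos d) => // q l qd lc.
move: lc; rewrite ltr_norml => /andP[lc1 lc2].
(* [l'] is the point of [-c, c] nearest to [l]. *)
have [l' l'c ll'] : exists2 l' : R, - c <= l' <= c & `|l - l'| < d.
  have [l1|l1] := ltP l (- c).
    by exists (- c); rewrite ?ltr_norml; lra.
  have [l2|l2] := ltP c l; first by exists c; rewrite ?ltr_norml; lra.
  by exists l; rewrite ?subrr ?normr0 ?l1.
(* The covering property given by [compactness_value_1d] stands under a double negation, hence the
   argument by contradiction. *)
apply: NNPP => nU; apply: (Hd l').
  by case/andP: l'c => ? ?; split; apply/RleP.
case=> t [[/RleP t1 /RleP t2] [/RltP /= t3 /RleP /= t4]]; apply: nU.
move: t3; rewrite RabsE RminusE !ltr_norml => /andP[t3 t3'].
move: ll'; rewrite ltr_norml => /andP[m1 m2].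
apply: (Hdelta t); first by rewrite ler_norml t1.
split=> /=; first by apply: ball_le qd; apply/RleP; lra.
by apply/ball_R; rewrite ltr_norml; lra.
Qed.

(** Leibniz' rule on [-c, c]: the lower endpoint enters with a minus sign and moves at speed -c', so
    both boundary terms carry +c'. The margin [d] places the hypotheses on a neighbourhood of the
    segment, where integrability for nearby t and continuity of the partial derivative are
    required. *)
Lemma is_derive_RInt_symmetric (f f1 : R -> R -> R) (c : R -> R) (c' d : R) :
  0 < d -> 0 <= c 0 ->
  (forall t l : R, `|t| < d -> `|l| < c 0 + d ->
     [/\ is_derive (f^~ l) t (f1 t l), continuity_2d_pt f1 t l &
         continuous (f t) l]) ->
  is_derive c 0 c' ->
  is_derive (fun t => RInt (f t) (- c t) (c t)) 0
    (RInt (f1 0) (- c 0) (c 0) + c' * (f 0 (c 0) + f 0 (- c 0))%R)%R.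
Proof.
move=> d0 c0 Hf Dc.
have /RltP Rd2 : 0 < d / 2 by lra.
have near0 : locally (0 : R) (fun t : R => `|t| < d / 2).
  by exists (mkposreal _ Rd2) => t /ball_R; rewrite subr0.
have D t l : `|t| < d -> `|l| < c 0 + d -> Derive (f^~ l) t = f1 t l.
  by move=> td lc; apply: is_derive_unique; case: (Hf t l td lc).
have C1 t l : `|t| < d -> `|l| < c 0 + d ->
    continuity_2d_pt (fun u v : R => Derive (f^~ v) u) t l.
  move=> td lc; case: (Hf t l td lc) => _ C1 _.
  apply: continuity_2d_pt_ext_loc C1.
  (* This radius keeps (u, v) inside the strip on which [D] identifies [Derive] with [f1]. *)
  have /RltP m0 : 0 < Order.min (d - `|t|) (c 0 + d - `|l|).
    by rewrite lt_min !subr_gt0 td lc.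
  exists (mkposreal _ m0) => u v /RltP /= u1 /RltP /= v1.
  move: u1 v1; rewrite !RabsE !RminusE !lt_min => /andP[u1 _] /andP[_ v1].
  rewrite D //.
    have -> : u = t + (u - t) by ring.
    by apply: le_lt_trans (ler_normD _ _) _; lra.
  have -> : v = l + (v - l) by ring.
  by apply: le_lt_trans (ler_normD _ _) _; lra.
have exR t (x y : R) : `|t| < d -> `|x| < c 0 + d -> `|y| < c 0 + d ->
    ex_RInt (f t) x y.
  move=> td; rewrite !ltr_norml => /andP[x1 x2] /andP[y1 y2].
  apply: ex_RInt_continuous => z [/RleP z1 /RleP z2].
  have zc : `|z| < c 0 + d.
    move: z1 z2; rewrite RminE RmaxE ge_min le_max ltr_norml.
    by case/orP=> z1 /orP[] z2; lra.
  by case: (Hf t z td zc).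
have C2 (l : R) : `|l| <= c 0 -> locally_2d (fun x' : R =>
    [eta continuity_2d_pt (fun u v : R => Derive (f^~ v) u) x']) 0 l.
  move=> lc; exists (mkposreal _ Rd2) => u v /RltP /= u1 /RltP /= v1.
  move: u1 v1; rewrite !RabsE !RminusE subr0 => u1 v1; apply: C1; first lra.
  have -> : v = l + (v - l) by ring.
  by apply: le_lt_trans (ler_normD _ _) _; lra.
have cl : `|- c 0| <= c 0 by rewrite normrN ger0_norm.
have cr : `|c 0| <= c 0 by rewrite ger0_norm.
have n0 : `|0 : R| < d by rewrite normr0.
have lt_c (l : R) : `|l| <= c 0 -> `|l| < c 0 + d by move=> ?; lra.
have cpt (l : R) : `|l| <= c 0 -> continuity_pt (f 0) l.
  move=> lc; apply/continuity_pt_filterlim.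
  by case: (Hf 0 l n0 (lt_c l lc)).
have near_d : locally (0 : R) (fun t : R => `|t| < d).
  by apply: filter_imp near0 => t td; lra.
have wide (l : R) : `|l| <= c 0 -> exists eps : posreal,
    locally (0 : R) (fun t : R => ex_RInt (f t) (l - eps) (l + eps)).
  rewrite ler_norml => /andP[l1 l2].
  exists (mkposreal _ Rd2); apply: filter_imp near_d => t td /=.
  by apply: exR; rewrite ?RminusE ?RplusE // ltr_norml; apply/andP; split; lra.
have Dl : is_derive (fun t => - c t) 0 (- c') by apply: is_derive_opp.
have seg (l : R) : Rmin (- c 0) (c 0) <= l <= Rmax (- c 0) (c 0) -> `|l| < c 0 + d.
  rewrite RminE RmaxE ge_min le_max ?RoppE => /andP[/orP l1 /orP l2].
  by rewrite ltr_norml; case: l1 => l1; case: l2 => l2; lra.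
have H := is_derive_RInt_param_bound_comp f (fun t => - c t) c 0 (- c') c'
  _ (wide _ cl) (wide _ cr) Dl Dc _ _ (C2 _ cl) (C2 _ cr) (cpt _ cl) (cpt _ cr).
apply: (is_derive_val (H _ _ _)).
- by apply: filter_imp near_d => t td; apply: exR => //; apply: lt_c.
- exists (mkposreal _ Rd2); apply: filter_imp near_d => t td l /= [/RleP l1 /RleP l2].
  have lc : `|l| < c 0 + d.
    move: l1 l2; rewrite RminE RmaxE ge_min le_max !RealsE ltr_norml.
    by case/orP=> l1 /orP[] l2; lra.
  by exists (f1 t l); case: (Hf t l td lc).
- by move=> l [/RleP l1 /RleP l2]; apply: C1 => //; apply: seg; rewrite l1.
have -> : RInt (fun t : R => Derive (f^~ t) 0) (- c 0) (c 0) = RInt (f1 0) (- c 0) (c 0).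
  apply: RInt_ext => l [/RltP l1 /RltP l2].
  by apply: D => //; apply: seg; rewrite !ltW.
rewrite !RealsE; ring.
Qed.

(** Matches the indices of (u, v) with those of (u, v, lambda), so that sums over 'I_3 restricted to
    i < 2 become sums over 'I_2; the lambda index is [ord_max]. *)
Definition up2 (i : 'I_2) : 'I_3 := widen_ord (isT : (2 <= 3)%N) i.

Lemma line_up2 (p : R2) (l t : R) i :
  plus ((p, l) : R3) (scal t (e3 (up2 i))) = (plus p (scal t (e2 i)), l).
Proof.
case: i => -[|[|//]] Hi; rewrite /e3 /e2 /plus /scal /= /mult /=;
  congr (_, _); rewrite -[RHS]addr0; congr (_ + _); exact: mulr0.
Qed.

Lemma line_ord_max (p : R2) (l t : R) :
  plus ((p, l) : R3) (scal t (e3 ord_max)) = (p, l + t)%R.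
Proof.
case: p => x y; rewrite /e3 /plus /scal /= /mult /=.
change ((x + t * 0, y + t * 0, l + t * 1) = (x, y, l + t)).
by rewrite !mulr0 !addr0 mulr1.
Qed.

(** Balls in R2 are products of intervals and the coordinates of [e2 i] are 0 or 1, so the
    parametrised line does not expand distances. *)
Lemma ball_line (p : R2) (i : 'I_2) (t u eps : R) : `|u - t| < eps ->
  ball (plus p (scal t (e2 i))) eps (plus p (scal u (e2 i))).
Proof.
move=> ut; have e0 : 0 < eps by apply: le_lt_trans ut.
case: p => x y.
have E b (z : R) : (b <= 1)%N -> ball (z + t * b%:R)%R eps (z + u * b%:R)%R.
  move=> b1; apply/ball_R.
  have -> : z + u * b%:R - (z + t * b%:R) = (u - t) * b%:R by ring.
  by case: b b1 => [|[|//]] _; rewrite ?mulr0 ?mulr1 ?normr0.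
by case: i => -[|[|//]] Hi; split; apply: (E _ _ _).
Qed.

Lemma normr_le_seg (c l : R) :
  0 <= c -> Rle (Rmin (- c) c) l -> Rle l (Rmax (- c) c) -> `|l| <= c.
Proof.
move=> c0; have Nc : - c <= c by lra.
have /RleP Nc' := Nc; rewrite Rmin_left // Rmax_right // => /RleP l1 /RleP l2.
by rewrite ler_norml l1.
Qed.

(** * Integrals over the fibres -h <= lambda <= h *)

Section Slab.
Variables (U : R3 -> Prop) (K : R3 -> R) (p : R2) (h : R2 -> R).
Hypotheses (oU : open U) (CK : Ck_open e3 1 U K) (h_ge0 : 0 <= h p).
Hypothesis segU : forall l : R, `|l| <= h p -> U (p, l).

Lemma continuous_fiber (f : R3 -> R) (x : R2) (l : R) :
  continuous f (x, l) -> continuous (fun l' => f (x, l')) l.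
Proof.
move=> Cf; apply: (@continuous_comp _ _ _ (fun v : R => (x, v)) f _ _ Cf).
apply/filterlim_locally => eps; exists eps => v vy.
by split=> //=; apply: ball_center.
Qed.

(** [tube] gives a uniform margin around the segment over [p] inside the region where [K] is C^1;
    [is_derive_RInt_symmetric] then applies along the i-th coordinate line through [p]. *)
Lemma is_derive_RInt_slab i (h' : R) :
  is_derive (along e2 h p i) 0 h' ->
  is_derive (along e2 (fun x => RInt (fun l => K (x, l)) (- h x) (h x)) p i) 0
    (RInt (fun l => pd e3 (up2 i) K (p, l)) (- h p) (h p)
     + h' * (K (p, h p) + K (p, - h p))%R)%R.
Proof.
move=> Dh; have [d d0 Hd] := tube oU h_ge0 segU.
have p0 : plus p (scal (0 : R) (e2 i)) = p by rewrite (@scal_zero_l _ _ (e2 i)) plus_zero_r.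
have := @is_derive_RInt_symmetric (fun t l => K (plus p (scal t (e2 i)), l))
  (fun t l => pd e3 (up2 i) K (plus p (scal t (e2 i)), l))
  (along e2 h p i) h' d d0.
rewrite along0 p0; apply=> // t l td lc.
have Up : U (plus p (scal t (e2 i)), l).
  by apply: Hd lc; rewrite -{1}p0; apply: ball_line; rewrite subr0.
split.
- have := @is_derive_along _ _ e3 0 U K (p, l) (up2 i) t CK.
  rewrite line_up2 => /(_ Up); apply: is_derive_ext => s.
  by rewrite /along line_up2.
- apply/continuity_2d_pt_filterlim.
  apply: (filterlim_comp _ _ _ (fun z : R * R => (plus p (scal z.1 (e2 i)), z.2))
    (pd e3 (up2 i) K) _ (locally (plus p (scal t (e2 i)), l))).
    apply/filterlim_locally => eps; exists eps => -[u v] [/= /ball_R ut vl].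
    by split=> //; apply: ball_line.
  by case: (Ck_pd (up2 i) CK) => C _; apply: C.
- apply: continuous_fiber; exact: (Ck_continuous CK Up).
Qed.

Lemma RInt_pd_ord_max :
  RInt (fun l => pd e3 ord_max K (p, l)) (- h p) (h p) =
  (K (p, h p) - K (p, - h p))%R.
Proof.
have seg (l : R) : Rle (Rmin (- h p) (h p)) l /\ Rle l (Rmax (- h p) (h p)) -> U (p, l).
  by case=> l1 l2; apply: segU; apply: normr_le_seg.
apply: is_RInt_unique.
apply: (is_RInt_derive (fun l => K (p, l))) => l /seg Up.
- have := @is_derive_along _ _ e3 0 U K (p, 0) ord_max l CK.
  rewrite line_ord_max add0r => /(_ Up); apply: is_derive_ext => s.
  by rewrite /along line_ord_max add0r.
- apply: continuous_fiber.
  by case: (Ck_pd ord_max CK) => C _; apply: C.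
Qed.

Lemma ex_RInt_pd i : ex_RInt (fun l => pd e3 i K (p, l)) (- h p) (h p).
Proof.
apply: ex_RInt_continuous => l [l1 l2].
apply: continuous_fiber; case: (Ck_pd i CK) => C _; apply: C.
by apply: segU; apply: normr_le_seg.
Qed.

End Slab.

(** * Geometry of the fracture *)

Lemma open_nonzero (T : UniformSpace) (U : T -> Prop) (f : T -> R) : open U ->
  (forall p, U p -> continuous f p) -> open (fun p => U p /\ f p <> 0).
Proof.
move=> oU Cf p [Up fp]; apply: filter_and; first exact: oU.
exact: (Cf p Up _ (open_neq 0 (f p) fp)).
Qed.

Lemma open_fst (U : R2 -> Prop) : open U -> open (fun x : R3 => U x.1).
Proof.
move=> oU x /oU [eps He]; exists eps => y [/= y1 _]; exact: He.
Qed.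

Lemma ord3_split (i : 'I_3) : i = ord_max \/ exists j, i = up2 j.
Proof.
case: i => -[|[|[|//]]] Hi; [right; exists ord0|right; exists ord_max|left];
  exact: val_inj.
Qed.

Lemma along_fst_up2 (f : R2 -> R) (x : R3) i t :
  along e3 (fun y : R3 => f y.1) x (up2 i) t = along e2 f x.1 i t.
Proof. by case: x => p l; rewrite /along line_up2. Qed.

Lemma along_fst_ord_max (f : R2 -> R) (x : R3) t :
  along e3 (fun y : R3 => f y.1) x ord_max t = f x.1.
Proof. by case: x => p l; rewrite /along line_ord_max. Qed.

(** The induction closes because the lambda-derivative of a lifted function is 0 and its u- and
    v-derivatives are again lifted functions. *)
Lemma Ck_fst k (U : R2 -> Prop) (f : R2 -> R) : open U -> Ck_open e2 k U f ->
  Ck_open e3 k (fun x => U x.1) (fun x => f x.1).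
Proof.
move=> oU; elim: k f => [|k IH] f Cf.
  split=> // x Ux; apply: (@continuous_comp _ _ _ fst f).
    exact: continuous_fst.
  exact: (Ck_continuous Cf).
apply: Ck_S; first exact: open_fst.
  move=> x Ux; apply: (@continuous_comp _ _ _ fst f).
    exact: continuous_fst.
  exact: (Ck_continuous Cf).
move=> i; case: (ord3_split i) => [->|[j ->]].
  exists (fun=> 0); last by apply: Ck_const; apply: open_fst.
  move=> x Ux; apply: is_derive_ext (is_derive_const (f x.1) _) => t.
  by rewrite along_fst_ord_max.
exists (fun x => pd e2 j f x.1); last by apply: IH; apply: Ck_pd.
move=> x Ux; apply: is_derive_ext (Ck_is_derive j Cf Ux) => t.
by rewrite along_fst_up2.
Qed.

Lemma is_derive_snd_up2 (x : R3) i : is_derive (along e3 (@snd R2 R) x (up2 i)) 0 0.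
Proof.
apply: is_derive_ext (is_derive_const x.2 _) => t.
by case: x => p l; rewrite /along line_up2.
Qed.

Lemma is_derive_snd_ord_max (x : R3) : is_derive (along e3 (@snd R2 R) x ord_max) 0 1.
Proof.
have D : is_derive (fun t : R => x.2 + t) 0 1.
  rewrite -[X in is_derive _ _ X]add0r; apply: is_derive_plus.
    exact: is_derive_const.
  exact: is_derive_id.
apply: is_derive_ext D => t.
by case: x => p l; rewrite /along line_ord_max.
Qed.

Lemma Ck_snd k (U : R3 -> Prop) : open U -> Ck_open e3 k U (@snd R2 R).
Proof.
move=> oU; case: k => [|k]; first by split=> // x _; apply: continuous_snd.
apply: Ck_S => // [x _|i]; first exact: continuous_snd.
case: (ord3_split i) => [->|[j ->]].
  exists (fun=> 1); last exact: Ck_const.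
  by move=> x Ux; apply: is_derive_snd_ord_max.
exists (fun=> 0); last exact: Ck_const.
by move=> x Ux; apply: is_derive_snd_up2.
Qed.

(** * Dot and cross products *)

Section Cross.
Variables x y : 'rV[R]_3.

Lemma dot3E (u v : 'rV[R]_3) : dot u v =
  (u 0 (inord 0) * v 0 (inord 0) + u 0 (inord 1) * v 0 (inord 1)
   + u 0 (inord 2) * v 0 (inord 2))%R.
Proof.
rewrite /dot !big_ord_recr big_ord0 /= add0r.
by congr (_ * _ + _ * _ + _ * _); congr (_ _ _); apply: val_inj; rewrite /= inordK.
Qed.

Lemma crossE :
  [/\ cross x y 0 (inord 0) =
        (x 0 (inord 1) * y 0 (inord 2) - x 0 (inord 2) * y 0 (inord 1))%R,
      cross x y 0 (inord 1) =
        (x 0 (inord 2) * y 0 (inord 0) - x 0 (inord 0) * y 0 (inord 2))%R &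
      cross x y 0 (inord 2) =
        (x 0 (inord 0) * y 0 (inord 1) - x 0 (inord 1) * y 0 (inord 0))%R].
Proof. by rewrite !mxE !inordK. Qed.

Lemma dot_crossl : dot x (cross x y) = 0.
Proof. by rewrite dot3E; case: crossE => -> -> ->; ring. Qed.

Lemma dot_crossr : dot y (cross x y) = 0.
Proof. by rewrite dot3E; case: crossE => -> -> ->; ring. Qed.

End Cross.

Lemma dotZr (k : R) (x y : 'rV[R]_3) : dot x (k *: y) = (k * dot x y)%R.
Proof.
rewrite /dot mulr_sumr; apply: eq_bigr => c _; rewrite mxE; ring.
Qed.

Lemma dotC (x y : 'rV[R]_3) : dot x y = dot y x.
Proof. by apply: eq_bigr => c _; rewrite mulrC. Qed.

Lemma dot_ge0 (x : 'rV[R]_3) : 0 <= dot x x.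
Proof. by apply: sumr_ge0 => c _; rewrite -expr2 sqr_ge0. Qed.

Lemma dot_normalize (x : 'rV[R]_3) : dot x x <> 0 ->
  dot ((norm3 x)^-1 *: x) ((norm3 x)^-1 *: x) = 1.
Proof.
move=> /eqP x0; rewrite dotZr dotC dotZr.
have : norm3 x * norm3 x = dot x x.
  by rewrite /norm3 RsqrtE -expr2 sqr_sqrtr ?dot_ge0.
have n0 : norm3 x != 0.
  by rewrite /norm3 RsqrtE gt_eqF // sqrtr_gt0 lt_neqAle eq_sym x0 dot_ge0.
by move=> <-; field.
Qed.

Lemma Ck_cross k (V : NormedModule R_AbsRing) n (e : 'I_n -> V) (U : V -> Prop)
    (x y : V -> 'rV[R]_3) : open U ->
  (forall c, Ck_open e k U (fun p => x p 0 c)) ->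
  (forall c, Ck_open e k U (fun p => y p 0 c)) ->
  forall c, Ck_open e k U (fun p => cross (x p) (y p) 0 c).
Proof.
move=> oU Cx Cy c; case: c => -[|[|[|//]]] Hc;
 [apply: (@Ck_ext _ _ e k U (fun p =>
    x p 0 (inord 1) * y p 0 (inord 2) - x p 0 (inord 2) * y p 0 (inord 1))%R)
 |apply: (@Ck_ext _ _ e k U (fun p =>
    x p 0 (inord 2) * y p 0 (inord 0) - x p 0 (inord 0) * y p 0 (inord 2))%R)
 |apply: (@Ck_ext _ _ e k U (fun p =>
    x p 0 (inord 0) * y p 0 (inord 1) - x p 0 (inord 1) * y p 0 (inord 0))%R)] => //;
 try (by move=> q _; rewrite !mxE);
 by apply: Ck_sub => //; apply: Ck_mul.
Qed.

Lemma Ck_dot k (V : NormedModule R_AbsRing) n (e : 'I_n -> V) (U : V -> Prop)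
    (x y : V -> 'rV[R]_3) : open U ->
  (forall c, Ck_open e k U (fun p => x p 0 c)) ->
  (forall c, Ck_open e k U (fun p => y p 0 c)) ->
  Ck_open e k U (fun p => dot (x p) (y p)).
Proof. by move=> oU Cx Cy; apply: Ck_sum => // c; apply: Ck_mul. Qed.

Lemma invmx_mul (F : comUnitRingType) n (A B : 'M[F]_n) :
  A \in unitmx -> B \in unitmx -> invmx (A *m B) = invmx B *m invmx A.
Proof.
move=> Au Bu; have ABu : A *m B \in unitmx by rewrite unitmx_mul Au.
apply: (can_inj (mulKmx ABu)).
by rewrite mulmxV // mulmxA mulmxK ?mulmxV.
Qed.

(** * Metric of the fracture and its inverse *)

Section Fracture.
Variables (r : R2 -> 'rV[R]_3) (U : R2 -> Prop).

Definition normal_dir (p : R2) : 'rV[R]_3 :=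
  cross (row ord0 (jacobian e2 r p)) (row ord_max (jacobian e2 r p)).

Hypotheses (oU : open U)
  (Cr : forall k c, Ck_open e2 k U (fun p => r p 0 c))
  (dir_neq0 : forall p, U p -> dot (normal_dir p) (normal_dir p) <> 0).

Lemma Ck_normal_dir k c : Ck_open e2 k U (fun p => normal_dir p 0 c).
Proof.
have Cj i d : Ck_open e2 k U (fun p => row i (jacobian e2 r p) 0 d).
  by apply: Ck_ext (Ck_pd i (Cr k.+1 d)) => // q _; rewrite !mxE.
by apply: Ck_cross.
Qed.

Lemma Ck_unit_normal k c : Ck_open e2 k U (fun p => unit_normal r p 0 c).
Proof.
have Cd := Ck_normal_dir k.
have dir_gt0 p : U p -> 0 < dot (normal_dir p) (normal_dir p).
  by move=> Up; rewrite lt_neqAle dot_ge0 eq_sym andbT; apply/eqP/dir_neq0.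
apply: (@Ck_ext _ _ _ _ _ (fun p => (norm3 (normal_dir p))^-1 * normal_dir p 0 c)%R) => //.
  by move=> q _; rewrite [RHS]mxE.
apply: Ck_mul => //; apply: Ck_inv => // [p Up|].
  by apply/eqP; rewrite gt_eqF // /norm3 RsqrtE sqrtr_gt0 dir_gt0.
by apply: Ck_sqrt => //; apply: Ck_dot.
Qed.

Let V (x : R3) := U x.1.
Let oV : open V := open_fst oU.

Lemma fractureE x c : (r x.1 0 c + x.2 * unit_normal r x.1 0 c)%R = fracture r x 0 c.
Proof. by rewrite !mxE. Qed.

Lemma Ck_fracture k c : Ck_open e3 k V (fun x => fracture r x 0 c).
Proof.
apply: (@Ck_ext _ _ e3 _ _ (fun x : R3 => r x.1 0 c + x.2 * unit_normal r x.1 0 c)%R) => // [q _|].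
  exact: fractureE.
apply: Ck_add => //; first by apply: (Ck_fst oU (Cr k c)).
apply: Ck_mul => //; first by apply: Ck_snd.
by apply: (Ck_fst oU (Ck_unit_normal k c)).
Qed.

Lemma pd_fracture_ord_max x c :
  pd e3 ord_max (fun y => fracture r y 0 c) x = unit_normal r x.1 0 c.
Proof.
apply: pd_eq.
have D : is_derive (fun t : R => r x.1 0 c + (x.2 + t) * unit_normal r x.1 0 c)%R 0
    (unit_normal r x.1 0 c).
  have D1 : is_derive (fun t : R => x.2 + t)%R 0 1.
    rewrite -[X in is_derive _ _ X]add0r; apply: is_derive_plus.
      exact: is_derive_const.
    exact: is_derive_id.
  have D2 := is_derive_scal_l _ _ _ (unit_normal r x.1 0 c) D1.
  apply: (is_derive_val (is_derive_plus _ _ _ _ _ (is_derive_const (r x.1 0 c) _) D2)).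
  by rewrite plus_zero_l scal_one.
apply: is_derive_ext D => t; case: x => p l.
by rewrite /along line_ord_max -fractureE.
Qed.

Lemma pd_fracture_up2 x i c : V x ->
  pd e3 (up2 i) (fun y => fracture r y 0 c) x =
  (pd e2 i (fun p => r p 0 c) x.1 + x.2 * pd e2 i (fun p => unit_normal r p 0 c) x.1)%R.
Proof.
move=> Vx; apply: pd_eq.
have D2 := is_derive_scal _ _ x.2 _ (Ck_is_derive i (Ck_unit_normal 1 c) Vx).
have D := is_derive_plus _ _ _ _ _ (Ck_is_derive i (Cr 1 c) Vx) D2.
apply: is_derive_ext D => t; case: x Vx D2 => p l Vx D2.
by rewrite /along line_up2 -fractureE.
Qed.

Lemma dot_unit_normal p : U p -> dot (unit_normal r p) (unit_normal r p) = 1.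
Proof. by move=> Up; apply: dot_normalize; apply: dir_neq0. Qed.

(** Differentiate the identity <n, n> = 1, which holds on the open set [U]. *)
Lemma dot_pd_unit_normal p i : U p ->
  (\sum_c pd e2 i (fun q => unit_normal r q 0 c) p * unit_normal r p 0 c)%R = 0.
Proof.
move=> Up.
have D : is_derive (along e2 (fun q => dot (unit_normal r q) (unit_normal r q)) p i) 0
   (\sum_c 2 * (pd e2 i (fun q => unit_normal r q 0 c) p * unit_normal r p 0 c))%R.
  apply: is_derive_sum => c.
  have Dc := Ck_is_derive i (Ck_unit_normal 1 c) Up.
  apply: (is_derive_val (is_derive_mult _ _ _ _ _ Dc Dc Rmult_comm)).
  rewrite along0; set a := unit_normal r p 0 c; set b := pd _ _ _ _.
  by change ((b * a + a * b)%R = (2 * (b * a))%R); ring.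
have : pd e2 i (fun q => dot (unit_normal r q) (unit_normal r q)) p = 0.
  rewrite (@pd_ext _ _ e2 _ _ (fun=> 1) _ i oU Up (fun q Uq => dot_unit_normal Uq)).
  exact: (pd_eq (is_derive_const (1 : R) _)).
rewrite (pd_eq D) -mulr_sumr => /eqP; rewrite mulf_eq0 pnatr_eq0 /=.
by move/eqP.
Qed.

(** The normal is a multiple of r_u x r_v, hence orthogonal to both factors. *)
Lemma row_dot_unit_normal p i : U p ->
  (\sum_c pd e2 i (fun q => r q 0 c) p * unit_normal r p 0 c)%R = 0.
Proof.
move=> Up.
have -> : (\sum_c pd e2 i (fun q => r q 0 c) p * unit_normal r p 0 c)%R
    = dot (row i (jacobian e2 r p)) (unit_normal r p).
  by apply: eq_bigr => c _; rewrite !mxE.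
rewrite dotZr; case: i => -[|[|//]] Hi.
  by rewrite (_ : Ordinal Hi = ord0) ?dot_crossl ?mulr0 //; exact: val_inj.
by rewrite (_ : Ordinal Hi = ord_max) ?dot_crossr ?mulr0 //; exact: val_inj.
Qed.

Lemma metricE x : metric r x = jacobian e3 (fracture r) x *m (jacobian e3 (fracture r) x)^T.
Proof. by apply/matrixP => i j; rewrite !mxE; apply: eq_bigr => c _; rewrite !mxE. Qed.

(** R_lambda = n has length 1, and R_i = r_i + lambda n_i is orthogonal to n for i = u, v. *)
Lemma metric_ord_max x i : V x -> metric r x i ord_max = (i == ord_max)%:R.
Proof.
move=> Vx; rewrite metricE mxE.
under eq_bigr => c _ do rewrite !mxE pd_fracture_ord_max //.
case: (ord3_split i) => [->|[j ->]].
  rewrite eqxx -(dot_unit_normal Vx); apply: eq_bigr => c _.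
  by rewrite pd_fracture_ord_max.
have -> : (up2 j == ord_max) = false by case: j => -[|[|//]].
under eq_bigr => c _ do rewrite pd_fracture_up2 // mulrDl -mulrA.
by rewrite big_split /= -mulr_sumr row_dot_unit_normal // dot_pd_unit_normal // mulr0 addr0.
Qed.

(** The immersion condition as a nonvanishing determinant: in this form continuity makes it an open
    condition, and it yields the invertibility of G. *)
Definition regular (x : R3) : Prop :=
  U x.1 /\ \det (jacobian e3 (fracture r) x) <> 0.

Lemma Ck_jacobian k i c : Ck_open e3 k V (fun x => jacobian e3 (fracture r) x i c).
Proof.
apply: Ck_ext (Ck_pd i (Ck_fracture k.+1 c)) => // x _; by rewrite mxE.
Qed.

Lemma open_regular : open regular.
Proof.
apply: (open_nonzero oV) => x Vx.
by apply: (@Ck_continuous _ _ e3 0) Vx; apply: Ck_det => // i j; apply: Ck_jacobian.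
Qed.

Lemma tr_metric x : (metric r x)^T = metric r x.
Proof. by rewrite metricE trmx_mul trmxK. Qed.

Lemma metric_unit x : regular x -> metric r x \in unitmx.
Proof.
by case=> _ /eqP J0; rewrite metricE unitmx_mul unitmx_tr andbb unitmxE unitfE.
Qed.

Lemma Ginv_sym x i j : Ginv r x i j = Ginv r x j i.
Proof. by rewrite /Ginv -[in LHS]tr_metric -trmx_inv mxE. Qed.

(** The last column of G is the last unit vector, so the last column of G^-1 G = 1 is the last
    column of G^-1. *)
Lemma Ginv_ord_max x i : regular x -> Ginv r x i ord_max = (i == ord_max)%:R.
Proof.
move=> Rx; have := mulVmx (metric_unit Rx).
move/matrixP/(_ i ord_max); rewrite !mxE => <-.
rewrite (bigD1 ord_max) //= metric_ord_max; last by case: Rx.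
rewrite eqxx mulr1 big1 ?addr0 // => j jm.
by rewrite metric_ord_max ?(negPf jm) ?mulr0 //; case: Rx.
Qed.

(** G = J J^T gives G^-1 = (J^-1)^T J^-1. *)
Lemma GinvE x i j : regular x -> Ginv r x i j =
  (\sum_c invmx (jacobian e3 (fracture r) x) c i * invmx (jacobian e3 (fracture r) x) c j)%R.
Proof.
case=> _ /eqP J0; rewrite /Ginv metricE.
have Ju : jacobian e3 (fracture r) x \in unitmx by rewrite unitmxE unitfE.
have Jt : (jacobian e3 (fracture r) x)^T \in unitmx by rewrite unitmx_tr.
rewrite invmx_mul // -trmx_inv mxE; apply: eq_bigr => c _; by rewrite mxE.
Qed.

(** * Gradient of W and C^1 regularity of the flux factors *)

Variables (W : R3 -> R).

Lemma gradG_ord_max x : regular x -> gradG r W x 0 ord_max = pd e3 ord_max W x.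
Proof.
move=> Rx; rewrite mxE (bigD1 ord_max) //= Ginv_ord_max // eqxx mul1r.
rewrite big1 ?addr0 // => i im.
by rewrite Ginv_ord_max // (negPf im) mul0r.
Qed.

Lemma sum_ord3 (F : 'I_3 -> R) :
  (\sum_i F i = \sum_(i < 2) F (up2 i) + F ord_max)%R.
Proof.
rewrite big_ord_recr /=; congr (_ + _); apply: eq_bigr => i _.
by congr F; apply: val_inj.
Qed.

Lemma gradG_up2 x i : regular x -> gradG r W x 0 (up2 i) =
  (\sum_(j < 2) Ginv r x (up2 i) (up2 j) * pd e3 (up2 j) W x)%R.
Proof.
move=> Rx; rewrite mxE sum_ord3 (Ginv_sym _ ord_max) Ginv_ord_max //.
have -> : (up2 i == ord_max) = false by case: i => -[|[|//]].
by rewrite mul0r addr0; apply: eq_bigr => j _; rewrite Ginv_sym.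
Qed.

(* The field w of the header: the coordinate gradient is J w, so |w| = |grad W|_G. *)
Definition frame_grad (c : 'I_3) (x : R3) : R :=
  (\sum_i invmx (jacobian e3 (fracture r) x) c i * pd e3 i W x)%R.

Lemma pd_frame_grad x j : regular x ->
  pd e3 j W x = (\sum_c jacobian e3 (fracture r) x j c * frame_grad c x)%R.
Proof.
case=> _ /eqP J0; set J := jacobian _ _ _.
have Ju : J \in unitmx by rewrite unitmxE unitfE.
under eq_bigr => c _ do rewrite /frame_grad -/J mulr_sumr.
rewrite exchange_big /=.
under eq_bigr => i _ do (under eq_bigr => c _ do rewrite mulrA; rewrite -mulr_suml).
have E i : (\sum_c J j c * invmx J c i)%R = (j == i)%:R.
  by have /matrixP/(_ j i) := mulmxV Ju; rewrite !mxE.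
under eq_bigr => i _ do rewrite E.
rewrite (bigD1 j) //= eqxx mul1r big1 ?addr0 // => i ij.
by rewrite eq_sym (negPf ij) mul0r.
Qed.

(** By [GinvE] the quadratic form of G^-1 is a sum of squares of the components of J^-1 grad W; this
    gives [Ck1_f_beta_mul] the Euclidean norm it needs. *)
Lemma normG_gradE x : regular x ->
  normG_grad r W x = sqrt (\sum_c frame_grad c x ^+ 2)%R.
Proof.
move=> Rx; congr sqrt.
under eq_bigr => i _ do under eq_bigr => j _ do rewrite GinvE // !mulr_suml.
under [RHS]eq_bigr => c _ do rewrite /frame_grad expr2 mulr_suml.
rewrite [RHS]exchange_big /=; apply: eq_bigr => i _.
under [RHS]eq_bigr => c _ do rewrite mulr_sumr.
rewrite [RHS]exchange_big /=; apply: eq_bigr => j _.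
by apply: eq_bigr => c _; ring.
Qed.

Lemma sqrt_detGE x : sqrt_detG r x = sqrt (\det (jacobian e3 (fracture r) x) ^+ 2)%R.
Proof. by rewrite /sqrt_detG metricE det_mulmx det_tr -expr2. Qed.

Variables (alpha beta : R).
Hypotheses (alpha_gt0 : 0 < alpha) (beta_ge0 : 0 <= beta).
Variable D : R3 -> Prop.
Hypotheses (oD : open D) (D_regular : forall x, D x -> regular x)
  (CW : forall i, Ck_open e3 1 D (pd e3 i W)).

(** As grad W = J w, the product is a combination, with the smooth coefficients J_jc, of the fields
    f_beta(|w|) w_c. *)
Lemma Ck1_flux j :
  Ck_open e3 1 D (fun x => (f_beta alpha beta (normG_grad r W x) * pd e3 j W x)%R).
Proof.
have CJ i c : Ck_open e3 1 D (fun x => jacobian e3 (fracture r) x i c).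
  by apply: Ck_subset (Ck_jacobian 1 i c) => x /D_regular[].
have CI : forall c i, Ck_open e3 1 D (fun x => invmx (jacobian e3 (fracture r) x) c i).
  by apply: Ck_invmx => // x /D_regular[].
have Cw c : Ck_open e3 1 D (frame_grad c).
  by apply: Ck_sum => // i; apply: Ck_mul.
apply: (@Ck_ext _ _ e3 _ _ (fun x : R3 => \sum_c jacobian e3 (fracture r) x j c *
   (f_beta alpha beta (sqrt (\sum_c frame_grad c x ^+ 2)%R) * frame_grad c x))%R) => //.
  move=> x /D_regular Rx; rewrite -normG_gradE // pd_frame_grad // mulr_sumr.
  by apply: eq_bigr => c _; ring.
apply: Ck_sum => // c; apply: Ck_mul => //.
exact: Ck1_f_beta_mul.
Qed.

(** Without a factor d_j W only continuity is claimed, because grad W may vanish; that is enough for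
    the integral defining L^ij to exist. *)
Lemma continuous_f_beta_normG x : D x ->
  continuous (fun y => f_beta alpha beta (normG_grad r W y)) x.
Proof.
move=> Dx.
have CJ i c : Ck_open e3 1 D (fun x => jacobian e3 (fracture r) x i c).
  by apply: Ck_subset (Ck_jacobian 1 i c) => y /D_regular[].
have CI : forall c i, Ck_open e3 1 D (fun x => invmx (jacobian e3 (fracture r) x) c i).
  by apply: Ck_invmx => // y /D_regular[].
have Cw c : Ck_open e3 1 D (frame_grad c).
  by apply: Ck_sum => // i; apply: Ck_mul.
apply: (@continuous_ext_open _ D (fun y =>
  f_beta alpha beta (sqrt (\sum_c frame_grad c y ^+ 2)%R))) => //.
  by move=> y /D_regular Ry; rewrite normG_gradE.
have Cq : continuous (fun y => \sum_c frame_grad c y ^+ 2)%R x.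
  by apply: (@Ck_continuous _ _ e3 1 D) => //; apply: Ck_sum => // c; apply: Ck_mul.
have Cs := continuous_comp _ _ _ Cq (continuous_sqrt _).
apply: (continuous_comp _ _ _ Cs); apply: continuous_f_beta => //.
by rewrite RsqrtE sqrtr_ge0.
Qed.

(** The radicand det G = (det J)^2 is positive on [D], so the root is taken where it is smooth. *)
Lemma Ck1_sqrt_detG : Ck_open e3 1 D (sqrt_detG r).
Proof.
have CJ i c : Ck_open e3 1 D (fun x => jacobian e3 (fracture r) x i c).
  by apply: Ck_subset (Ck_jacobian 1 i c) => x /D_regular[].
apply: (@Ck_ext _ _ e3 _ _ (fun x : R3 => sqrt (\det (jacobian e3 (fracture r) x) ^+ 2)%R)) => //.
  by move=> x _; rewrite sqrt_detGE.
apply: Ck_sqrt => // [x /D_regular[_ /eqP J0]|].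
  by rewrite lt_neqAle sqr_ge0 eq_sym expf_neq0.
by apply: Ck_mul => //; apply: Ck_det.
Qed.

Lemma Ck1_Ginv i j : Ck_open e3 1 D (fun x => Ginv r x i j).
Proof.
have CJ d c : Ck_open e3 1 D (fun x => jacobian e3 (fracture r) x d c).
  by apply: Ck_subset (Ck_jacobian 1 d c) => x /D_regular[].
have CI : forall c d, Ck_open e3 1 D (fun x => invmx (jacobian e3 (fracture r) x) c d).
  by apply: Ck_invmx => // x /D_regular[].
apply: (@Ck_ext _ _ e3 _ _ (fun x : R3 => \sum_c invmx (jacobian e3 (fracture r) x) c i
   * invmx (jacobian e3 (fracture r) x) c j)%R) => //.
  by move=> x /D_regular Rx; rewrite GinvE.
by apply: Ck_sum => // c; apply: Ck_mul.
Qed.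

End Fracture.

(** * The thickness-integrated equation *)

Lemma locally_lt (T : UniformSpace) (f g : T -> R) x :
  continuous f x -> continuous g x -> f x < g x -> locally x (fun y => f y < g y).
Proof.
move=> Cf Cg fg.
have Cd : continuous (fun y => g y + - f y)%R x.
  by apply: continuous_addr => //; apply: (@continuous_opp _ _ R_NormedModule).
have d0 : Rlt 0 (g x + - f x)%R by apply/RltP; rewrite subr_gt0.
have H : locally x (fun y => Rlt 0 (g y + - f y)%R) := Cd _ (open_gt 0 _ d0).
apply: filter_imp H => y /RltP.
by rewrite -[f y < g y]subr_gt0.
Qed.

Lemma open_forall3 (T : UniformSpace) (U : 'I_3 -> T -> Prop) :
  (forall i, open (U i)) -> open (fun x => forall i, U i x).
Proof.
move=> oU x Ux.
apply: filter_imp (filter_and _ _ (oU ord_max x (Ux _))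
  (filter_and _ _ (oU (up2 ord0) x (Ux _)) (oU (up2 ord_max) x (Ux _)))).
move=> y [y2 [y0 y1]] i; case: (ord3_split i) => [->|[j ->]] //.
case: j => -[|[|//]] Hj.
  by rewrite (_ : Ordinal Hj = ord0) //; exact: val_inj.
by rewrite (_ : Ordinal Hj = ord_max) //; exact: val_inj.
Qed.

(** Regularity of each of three components comes with its own neighbourhood; the intersection serves
    all of them at once. *)
Lemma choose_open3 (T : UniformSpace) (S : T -> Prop) (P : 'I_3 -> (T -> Prop) -> Prop) :
  (forall i, exists U, [/\ open U, forall p, S p -> U p & P i U]) ->
  exists U : 'I_3 -> T -> Prop,
    [/\ open (fun x => forall i, U i x), forall p, S p -> forall i, U i p &
        forall i, P i (U i)].
Proof.
move=> H; have [U HU] := functional_choice _ H; exists U; split.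
- by apply: open_forall3 => i; case: (HU i).
- by move=> p Sp i; case: (HU i) => _ SU _; apply: SU.
- by move=> i; case: (HU i).
Qed.

Lemma is_RInt_sum (I : Type) (s : seq I) (F : I -> R -> R) (v : I -> R) (a b : R) :
  (forall i, is_RInt (F i) a b (v i)) ->
  is_RInt (fun t => \sum_(i <- s) F i t)%R a b (\sum_(i <- s) v i)%R.
Proof.
move=> HF; elim: s => [|i s IH].
  have := is_RInt_const a b (0 : R); rewrite scal_zero_r big_nil.
  by apply: is_RInt_ext => t _; rewrite big_nil.
rewrite big_cons; apply: is_RInt_ext (is_RInt_plus _ _ _ _ _ _ (HF i) IH) => t _.
by rewrite big_cons.
Qed.

(** The lambda-row of the Jacobian is the unit normal, and full rank forbids a zero row. *)
Lemma immersion_unit_normal_neq0 (r : R2 -> 'rV[R]_3) (p : R2) (l : R) :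
  row_free (jacobian e3 (fracture r) (p, l)) ->
  dot (normal_dir r p) (normal_dir r p) <> 0.
Proof.
move=> /row_free_inj Jinj d0.
have n0 : unit_normal r p = 0.
  rewrite /unit_normal -/(normal_dir r p) /norm3 d0 sqrt_0.
  (* Where r_u x r_v vanishes, 0^-1 = 0 makes the unit normal 0. *)
  by rewrite (_ : (IZR 0)^-1 = 0) ?scale0r //; exact: invr0.
have : delta_mx 0 ord_max *m jacobian e3 (fracture r) (p, l) =
       (0 : 'rV[R]_3) *m jacobian e3 (fracture r) (p, l).
  rewrite mul0mx -rowE; apply/rowP => c.
  by rewrite !mxE pd_fracture_ord_max n0 mxE.
move/Jinj/matrixP/(_ 0 ord_max); rewrite !mxE !eqxx /= => /eqP.
by rewrite oner_eq0.
Qed.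

Lemma dot_vec3 (v : 'rV[R]_3) (x y z : R) :
  dot v (vec3 x y z) =
  (v 0 (up2 ord0) * x + v 0 (up2 ord_max) * y + v 0 ord_max * z)%R.
Proof.
rewrite /dot sum_ord3 big_ord_recl big_ord1 !mxE /=.
by rewrite (_ : lift ord0 ord0 = ord_max) //; exact: val_inj.
Qed.

(** * Fluxes, boundary conditions and derivatives of the averaged flux *)

Section Assembly.
Variables (r : R2 -> 'rV[R]_3) (U : R2 -> Prop) (W : R3 -> R) (D : R3 -> Prop)
  (h : R2 -> R) (alpha beta : R).
Hypotheses (oU : open U)
  (Cr : forall k c, Ck_open e2 k U (fun p => r p 0 c))
  (dir_neq0 : forall p, U p -> dot (normal_dir r p) (normal_dir r p) <> 0)
  (oD : open D) (D_regular : forall x, D x -> regular r U x)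
  (CW : forall i, Ck_open e3 1 D (pd e3 i W))
  (alpha_gt0 : 0 < alpha) (beta_ge0 : 0 <= beta).

(** The quantity K^ij of the header, with the factor d_j W included. *)
Definition flux i j (x : R3) : R :=
  (f_beta alpha beta (normG_grad r W x) * sqrt_detG r x * Ginv r x i j
   * pd e3 j W x)%R.

Definition flux_normal (x : R3) : R :=
  (f_beta alpha beta (normG_grad r W x) * sqrt_detG r x * pd e3 ord_max W x)%R.

Let Cf := Ck1_flux oU Cr dir_neq0 alpha_gt0 beta_ge0 oD D_regular CW.
Let CS := Ck1_sqrt_detG oU Cr dir_neq0 oD D_regular.
Let CG := Ck1_Ginv oU Cr dir_neq0 oD D_regular.

Lemma Ck1_flux_tensor i j : Ck_open e3 1 D (flux i j).
Proof.
apply: (Ck_ext oD _ (Ck_mul oD (Ck_mul oD (Cf j) CS) (CG i j))) => x _.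
rewrite /flux; ring.
Qed.

Lemma Ck1_flux_normal : Ck_open e3 1 D flux_normal.
Proof.
apply: (Ck_ext oD _ (Ck_mul oD (Cf ord_max) CS)) => x _.
rewrite /flux_normal; ring.
Qed.

(** Multiplying by [area_factor] clears the normalisation of the normal (-h_u, -h_v, s). Since G^i3
    = delta_i3, the lambda-component of the velocity involves only d_lambda W and the other two only
    d_u W and d_v W. Keeping [s] general treats both faces at once. *)
Lemma flux_boundary x p s (q : R) : D x ->
  dot (velocity r alpha beta W x)
      ((area_factor h p)^-1 *: vec3 (- h_u h p) (- h_v h p) s) = - q ->
  (q * area_factor h p * sqrt_detG r x =
   s * flux_normal x - \sum_(i < 2) pd e2 i h p * \sum_(j < 2) flux (up2 i) (up2 j) x)%R.
Proof.
move=> Dx; have Rx := D_regular Dx.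
have a0 : area_factor h p != 0.
  rewrite /area_factor RsqrtE gt_eqF // sqrtr_gt0.
  have : 0 <= h_u h p ^+ 2 + h_v h p ^+ 2 by rewrite addr_ge0 ?sqr_ge0.
  by change (0 <= h_u h p ^+ 2 + h_v h p ^+ 2 -> 0 < (1 + h_u h p ^+ 2 + h_v h p ^+ 2)%R); lra.
have E i : velocity r alpha beta W x 0 i =
    - (f_beta alpha beta (normG_grad r W x) * gradG r W x 0 i)%R.
  by rewrite /velocity [LHS]mxE [in LHS]mxE.
rewrite dotZr dot_vec3 !E (gradG_ord_max oU Cr dir_neq0 _ Rx)
  !(gradG_up2 oU Cr dir_neq0 _ _ Rx) => /eqP.
rewrite eq_sym eqr_oppLR => /eqP ->.
have F i : (\sum_(j < 2) flux i (up2 j) x)%R =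
   (f_beta alpha beta (normG_grad r W x) * sqrt_detG r x *
   \sum_(j < 2) Ginv r x i (up2 j) * pd e3 (up2 j) W x)%R.
  by rewrite mulr_sumr; apply: eq_bigr => j _; rewrite /flux !mulrA.
under [in RHS]eq_bigr => i _ do rewrite F.
rewrite [in RHS]big_ord_recl big_ord1 /flux_normal.
rewrite (_ : lift ord0 ord0 = ord_max); last exact: val_inj.
rewrite -/(h_u h p) -/(h_v h p).
by rewrite !RoppE; field.
Qed.

(** The integral is split termwise, each term being continuous on the fibre, and the
    lambda-derivative integrates to its endpoint values. *)
Lemma RInt_flow q : 0 <= h q -> (forall l : R, `|l| <= h q -> D (q, l)) ->
  RInt (fun l => (\sum_(i < 3 | (i < 2)%N) \sum_(j < 3 | (j < 2)%N)
                    pd e3 i (flux i j) (q, l)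
                  + pd e3 ord_max flux_normal (q, l))%R) (- h q) (h q) =
  (\sum_(i < 2) \sum_(j < 2)
     RInt (fun l => pd e3 (up2 i) (flux (up2 i) (up2 j)) (q, l)) (- h q) (h q)
   + (flux_normal (q, h q) - flux_normal (q, - h q)))%R.
Proof.
move=> h0 segD; apply: is_RInt_unique.
have Ck i j := Ck1_flux_tensor i j.
apply: is_RInt_plus; last first.
  rewrite -(RInt_pd_ord_max Ck1_flux_normal h0 segD).
  by apply: RInt_correct; apply: (ex_RInt_pd Ck1_flux_normal h0 segD).
apply: (is_RInt_ext (fun l => \sum_(i < 2) \sum_(j < 2)
    pd e3 (up2 i) (flux (up2 i) (up2 j)) (q, l))%R).
  move=> l _; rewrite (big_ord_narrow (isT : (2 <= 3)%N)); apply: eq_bigr => i _.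
  by rewrite (big_ord_narrow (isT : (2 <= 3)%N)).
apply: is_RInt_sum => i; apply: is_RInt_sum => j.
by apply: RInt_correct; apply: (ex_RInt_pd (Ck _ _) h0 segD).
Qed.

(** Independence of lambda moves d_j W under the integral defining L^ij, giving the integral of
    K^ij, which [is_derive_RInt_slab] differentiates. The identity is established on an open set
    [O], so both sides have the same derivatives there. *)
Lemma pd_Lcoef_mul (O : R3 -> Prop) q l i j : open O -> O (q, l) ->
  (forall x, O x -> 0 <= h x.1) ->
  (forall x (l' : R), O x -> `|l'| <= h x.1 -> D (x.1, l')) ->
  (forall x (l' : R), O x -> `|l'| <= h x.1 ->
     pd e3 (up2 j) W (x.1, l') = pd e3 (up2 j) W x) ->
  ex_derive (along e2 h q i) 0 ->
  pd e3 (up2 i) (fun x => Lcoef r alpha beta h W (up2 i) (up2 j) x.1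
                          * pd e3 (up2 j) W x)%R (q, l) =
  (RInt (fun l => pd e3 (up2 i) (flux (up2 i) (up2 j)) (q, l)) (- h q) (h q)
   + pd e2 i h q * (flux (up2 i) (up2 j) (q, h q)
                    + flux (up2 i) (up2 j) (q, - h q)))%R.
Proof.
move=> oO Oq h0 segD indep /Derive_correct Dh.
have E x : O x -> (Lcoef r alpha beta h W (up2 i) (up2 j) x.1 * pd e3 (up2 j) W x)%R
    = RInt (fun l => flux (up2 i) (up2 j) (x.1, l)) (- h x.1) (h x.1).
  move=> Ox; rewrite mulrC /Lcoef.
  rewrite -[LHS](RInt_scal (V := R_CompleteNormedModule)).
    apply: RInt_ext => l' [/RltP l1 /RltP l2].
    rewrite -(indep x l') //; last first.
      by apply: normr_le_seg; rewrite ?h0 //; apply/RleP; apply: ltW.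
    exact: mulrC.
  apply: ex_RInt_continuous => l' [l1 l2].
  have Dx : D (x.1, l') by apply: segD => //; apply: normr_le_seg; rewrite ?h0.
  apply: (continuous_fiber (f := fun y => f_beta alpha beta (normG_grad r W y)
     * sqrt_detG r y * Ginv r y (up2 i) (up2 j))%R).
  apply: continuous_mulr; last exact: (Ck_continuous (CG _ _) Dx).
  apply: continuous_mulr; last exact: (Ck_continuous CS Dx).
  exact: (continuous_f_beta_normG oU Cr dir_neq0 alpha_gt0 beta_ge0 oD D_regular CW Dx).
rewrite (@pd_ext _ _ e3 _ _ (fun x => RInt (fun l => flux (up2 i) (up2 j) (x.1, l))
  (- h x.1) (h x.1)) _ (up2 i) oO Oq E).
have hq : 0 <= h q := h0 _ Oq.
have segq (l' : R) : `|l'| <= h q -> D (q, l') by apply: (segD (q, l)).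
apply: pd_eq.
apply: is_derive_ext (is_derive_RInt_slab oD (Ck1_flux_tensor _ _) hq segq Dh) => t.
by rewrite (along_fst_up2 (fun p => RInt (fun l => flux (up2 i) (up2 j) (p, l)) (- h p) (h p))).
Qed.

End Assembly.

Theorem proposition3
  (L a b : R) (L_gt0 : 0 < L) (lt_ab : a < b)
  (r : R2 -> 'rV[R]_3)
  (r_smooth : forall c : 'I_3,
     smooth_on e2 (rect_closed L a b) (fun p => r p 0 c))
  (r_immersion : immersion_on e2 (rect_closed L a b) r)
  (h : R2 -> R)
  (h_smooth : smooth_on e2 (rect_closed L a b) h)
  (h_gt0 : forall p, rect_closed L a b p -> 0 < h p)
  (fracture_immersion :
     immersion_on e3 (Omega_f_closure L a b h) (fracture r))
  (alpha beta : R) (alpha_gt0 : 0 < alpha) (beta_ge0 : 0 <= beta)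
  (Q vol : R) (vol_gt0 : 0 < vol)
  (q_plus q_minus : R2 -> R)
  (W : R3 -> R)
  (W_C2 : Ck_on e3 2 (Omega_f_closure L a b h) W)
  (gradW_C2 : forall i : 'I_3,
     Ck_on e3 2 (Omega_f_closure L a b h) (pd e3 i W))
  (flow : forall p : R2, rect_open L a b p ->
     - (Q / vol) * RInt (fun l => sqrt_detG r (p, l)) (- h p) (h p) =
     RInt (fun l =>
             (\sum_(i < 3 | (i < 2)%N) \sum_(j < 3 | (j < 2)%N)
               pd e3 i (fun x => f_beta alpha beta (normG_grad r W x)
                                 * sqrt_detG r x * Ginv r x i j
                                 * pd e3 j W x) (p, l))
             + pd e3 ord_max (fun x => f_beta alpha beta (normG_grad r W x)
                                       * sqrt_detG r x
                                       * pd e3 ord_max W x) (p, l))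
          (- h p) (h p))
  (bc_w : forall p : R3, Gamma_w L a b h p -> W p = 0)
  (bc_f_plus : forall p : R3, Gamma_f_plus L a b h p ->
     dot (velocity r alpha beta W p) (n_f_plus h p.1) = - q_plus p.1)
  (bc_f_minus : forall p : R3, Gamma_f_minus L a b h p ->
     dot (velocity r alpha beta W p) (n_f_minus h p.1) = - q_minus p.1)
  (bc_f_out : forall p : R3, Gamma_f_out L a b h p ->
     dot (velocity r alpha beta W p) n_f_out = 0)
  (bc_out_plus : forall p : R3, Gamma_out_plus L a b h p ->
     dot (velocity r alpha beta W p) n_out_plus = 0)
  (bc_out_minus : forall p : R3, Gamma_out_minus L a b h p ->
     dot (velocity r alpha beta W p) n_out_minus = 0)
  (gradW_indep : forall (i : 'I_3) (p : R2) (l l' : R),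
     Omega_f_closure L a b h (p, l) -> Omega_f_closure L a b h (p, l') ->
     pd e3 i W (p, l) = pd e3 i W (p, l')) :
  forall p : R3, Omega_f L a b h p ->
    - (\sum_(i < 3 | (i < 2)%N) \sum_(j < 3 | (j < 2)%N)
         pd e3 i (fun x => Lcoef r alpha beta h W i j x.1 * pd e3 j W x) p)
    = Q / vol * area_A r h p.1
      + q_tilde_plus r h q_plus p.1 + q_tilde_minus r h q_minus p.1.
Proof.
have clo (p : R2) (l : R) : rect_closed L a b p -> `|l| <= h p ->
    Omega_f_closure L a b h (p, l).
  by move=> Rp; rewrite ler_norml => /andP[l1 l2]; split; rewrite //= l1 l2.
have [Ur [oUr SUr Cr]] := choose_open3 (P := fun c V =>
  forall k, Ck_open e2 k V (fun p => r p 0 c)) r_smooth.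
have [UW [oUW SUW CW]] := choose_open3 (P := fun i V => Ck_open e3 2 V (pd e3 i W)) gradW_C2.
have [Uh [oUh SUh Ch]] := h_smooth.
pose U0 (p : R2) := forall c, Ur c p.
have Cr0 k c : Ck_open e2 k U0 (fun p => r p 0 c).
  by apply: Ck_subset (Cr c k) => p; apply.
(* The neighbourhood where r is smooth is shrunk to the open part where r_u x r_v does not vanish,
   so that the unit normal is smooth on it. *)
pose U p := U0 p /\ dot (normal_dir r p) (normal_dir r p) <> 0.
have oU : open U.
  apply: (open_nonzero oUr) => p Up; apply: (@Ck_continuous _ _ e2 0) Up.
  apply: Ck_dot => [|c|c]; [exact: oUr| |]; exact: (Ck_normal_dir (U := U0) oUr Cr0).
have CrU k c : Ck_open e2 k U (fun p => r p 0 c).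
  by apply: Ck_subset (Cr0 k c) => p [].
have dir0 p : U p -> dot (normal_dir r p) (normal_dir r p) <> 0 by case.
have SU p : rect_closed L a b p -> U p.
  move=> Rp; split; first exact: SUr.
  (* The midsurface lambda = 0 lies in the fracture, so its immersion hypothesis can be used at (p,
     0). *)
  apply: (@immersion_unit_normal_neq0 _ _ 0); apply: fracture_immersion.
  by apply: clo => //; rewrite normr0 ltW // h_gt0.
(* An open neighbourhood of the closed fracture domain on which J is invertible and grad W is
   differentiable. *)
pose D x := regular r U x /\ forall i, UW i x.
have oD : open D.
  move=> x [Rx Wx]; apply: filter_and; last exact: oUW.
  exact: (open_regular oU CrU dir0).
have CD i : Ck_open e3 1 D (pd e3 i W).
  by apply: Ck_subset (Ck_lower _ (CW i)) => // x [_]; apply.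
have SD x : Omega_f_closure L a b h x -> D x.
  move=> Cx; split; last exact: SUW.
  split; first by apply: SU; case: Cx.
  by have := fracture_immersion _ Cx; rewrite row_free_unit unitmxE unitfE => /eqP.
have DR x : D x -> regular r U x by case.
have op_cl p : rect_open L a b p -> rect_closed L a b p.
  by move=> [/andP[? ?] /andP[? ?]]; split; rewrite !ltW.
(* [pd_Lcoef_mul] differentiates an identity and therefore needs it on an open set. *)
have oO : open (Omega_f L a b h).
  move=> x [[/andP[u0 uL] /andP[va vb]] /andP[lh hl]].
  have Cu : continuous (fun y : R3 => y.1.1) x.
    by apply: (continuous_comp fst fst); apply: continuous_fst.
  have Cv : continuous (fun y : R3 => y.1.2) x.
    by apply: (continuous_comp fst snd); [apply: continuous_fst|apply: continuous_snd].
  have Cl : continuous (fun y : R3 => y.2) x by apply: continuous_snd.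
  have Chx : continuous (fun y : R3 => h y.1) x.
    apply: (continuous_comp fst h); first exact: continuous_fst.
    apply: (Ck_continuous (Ch 0%N)); apply: SUh; apply: op_cl.
    by split; rewrite ?u0 ?va.
  have CNh : continuous (fun y : R3 => - h y.1) x.
    exact: (continuous_opp _ _ Chx).
  have Ck (c : R) : continuous (fun=> c) x by apply: continuous_const.
  apply: filter_imp (filter_and _ _
    (filter_and _ _ (filter_and _ _ (locally_lt (Ck 0) Cu u0) (locally_lt Cu (Ck L) uL))
                    (filter_and _ _ (locally_lt (Ck a) Cv va) (locally_lt Cv (Ck b) vb)))
    (filter_and _ _ (locally_lt CNh Cl lh) (locally_lt Cl Chx hl))).
  by move=> y [[[? ?] [? ?]] [? ?]]; split; first split; apply/andP.
have OL x : Omega_f L a b h x -> Omega_f_closure L a b h x.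
  by move=> [/op_cl ? /andP[? ?]]; split; rewrite ?ltW.
have O_h x : Omega_f L a b h x -> 0 <= h x.1.
  by case=> /op_cl /h_gt0 /ltW.
have O_seg x (l : R) : Omega_f L a b h x -> `|l| <= h x.1 -> Omega_f_closure L a b h (x.1, l).
  by case=> /op_cl Rx _; apply: clo.
case=> q l Oql; have [Rq _] := Oql; have hq := O_h _ Oql.
have clq := O_seg _ _ Oql.
have Dq (l' : R) : `|l'| <= h q -> D (q, l') by move=> /clq /SD.
have nh : `|h q| <= h q by rewrite ger0_norm.
have nh' : `|- h q| <= h q by rewrite normrN.
(* The upper and lower faces are the cases s = 1 and s = -1. *)
have Eplus := flux_boundary oU CrU dir0 DR (Dq _ nh)
  (bc_f_plus (q, h q) (conj (clq _ nh) erefl)).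
have Eminus := flux_boundary oU CrU dir0 DR (Dq _ nh')
  (bc_f_minus (q, - h q) (conj (clq _ nh') erefl)).
have Eflow := flow q Rq.
rewrite (RInt_flow oU CrU dir0 oD DR CD alpha_gt0 beta_ge0 hq Dq) in Eflow.
have Dh i : ex_derive (along e2 h q i) 0.
  by case: (Ch 1%N) => _ /(_ i) [H _]; apply: H; apply: SUh; apply: op_cl.
have ind j x (l' : R) : Omega_f L a b h x -> `|l'| <= h x.1 ->
    pd e3 (up2 j) W (x.1, l') = pd e3 (up2 j) W x.
  case: x => x l0 Ox Hl.
  exact: (gradW_indep (up2 j) x l' l0 (O_seg _ _ Ox Hl) (OL _ Ox)).
have EL (i j : 'I_2) := @pd_Lcoef_mul r U W D h alpha beta oU CrU dir0 oD DR CD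
  alpha_gt0 beta_ge0 (Omega_f L a b h) q l i j oO Oql O_h
  (fun x l' Ox Hl => SD _ (O_seg x l' Ox Hl)) (ind j) (Dh i).
rewrite (big_ord_narrow (isT : (2 <= 3)%N)).
(* Leibniz' rule, term by term: the integrated derivatives, then the boundary terms at h and at
   -h. *)
have -> : \sum_(i < 2) \sum_(j < 3 | (j < 2)%N)
     pd e3 (up2 i) (fun x => Lcoef r alpha beta h W (up2 i) j x.1 * pd e3 j W x)%R (q, l)
  = (\sum_(i < 2) \sum_(j < 2)
      RInt (fun l => pd e3 (up2 i) (flux r W alpha beta (up2 i) (up2 j)) (q, l)) (- h q) (h q)
   + (\sum_(i < 2) pd e2 i h q * \sum_(j < 2) flux r W alpha beta (up2 i) (up2 j) (q, h q)
   + \sum_(i < 2) pd e2 i h q * \sum_(j < 2) flux r W alpha beta (up2 i) (up2 j) (q, - h q)))%R.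
  rewrite -!big_split /=; apply: eq_bigr => i _.
  rewrite (big_ord_narrow (isT : (2 <= 3)%N)) -mulrDr -big_split /=
    mulr_sumr -big_split /=.
  apply: eq_bigr => j _; rewrite -[widen_ord _ j]/(up2 j); exact: EL.
(* [S1] is the integrated divergence, [S2] and [S3] are the Leibniz terms at h and -h, [Fp] and [Fm]
   the lambda-fluxes there. The boundary conditions express [Qp] and [Qm] through these, and the
   flow equation eliminates [S1]. *)
have conclude (A S1 S2 S3 Qp Qm Fp Fm c : R) :
    (Qp = 1 * Fp - S2 -> Qm = -1 * Fm - S3 -> - c * A = S1 + (Fp - Fm) ->
     - (S1 + (S2 + S3)) = c * A + Qp + Qm)%R.
  by move=> -> -> E; rewrite -[c * A]opprK -mulNr E; ring.
exact: conclude Eplus Eminus Eflow.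
Qed.
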